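(* Let $X$ and $Y$ be operator spaces that are strongly TRO equivalent by TRO's $M_1$ and $M_2$, i.e. $X=[M_2YM_1^*]^{-\|\cdot\|}$ and $Y=[M_2^*XM_1]^{-\|\cdot\|}$. If the C*-algebras $$A=[M_2M_2^*]^{-\|\cdot\|},\quad B=[M_1M_1^*]^{-\|\cdot\|},\quad C=[M_2^*M_2]^{-\|\cdot\|},\quad D=[M_1^*M_1]^{-\|\cdot\|}$$ admit countable approximate identities, then $X$ and $Y$ are stably isomorphic.
   Context: An operator space is a norm closed subspace of $\mathcal{B}(K_1,K_2)$ ($K_1,K_2$ Hilbert spaces). $[S]^{-\|\cdot\|}$ denotes the norm closed linear span of $S$. A TRO is an operator space $M$ with $MM^*M\subseteq M$. $X\subseteq \mathcal{B}(K_1,K_2)$ and $Y\subseteq \mathcal{B}(H_1,H_2)$ are strongly TRO equivalent by $M_1,M_2$ if $M_1\subseteq \mathcal{B}(H_1,K_1)$ and $M_2\subseteq\mathcal{B}(H_2,K_2)$ are TRO's satisfying the identities in the claim. For an operator space $X\subseteq\mathcal{B}(K_1,K_2)$, $\mathcal{K}_\infty(X)\subseteq \mathcal{B}(K_1^{(\infty)},K_2^{(\infty)})$ is the norm closure of the finitely supported infinite matrices with entries in $X$. Operator spaces $X$ and $Y$ are stably isomorphic if $\mathcal{K}_\infty(X)$ and $\mathcal{K}_\infty(Y)$ are completely isometrically isomorphic. *)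

(* Defs.v *)
From HB Require Import structures.
From mathcomp Require Import all_boot all_order all_algebra sesquilinear.
From mathcomp Require Import all_classical all_reals.
From mathcomp Require Import topology normedtype sequences.
From mathcomp Require Import complex ring lra.

Set Implicit Arguments.
Unset Strict Implicit.
Unset Printing Implicit Defensive.

Import Order.TTheory GRing.Theory Num.Theory.
Import numFieldNormedType.Exports.

Local Open Scope classical_set_scope.
Local Open Scope ring_scope.
Local Open Scope complex_scope.

HB.mixin Record CompleteNormedModule_isHilbert (R : realType) H
    & CompleteNormedModule R[i] H := {
  hdot : {dot H for (@Num.conj R[i])} ;
  hdot_norm : forall x : H, `|x| ^+ 2 = hdot x x
}.

#[short(type="hilbertType")]
HB.structure Definition Hilbert (R : realType) :=
  {H of CompleteNormedModule R[i] H & CompleteNormedModule_isHilbert R H}.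

Section RealNorm.
Variables (R : realType) (V : normedModType R[i]).
Implicit Types x y : V.

(* The norm of a [normedModType R[i]] takes its values in [R[i]]; [rnorm] is
   the same norm with values in [R]. *)
Definition rnorm x : R := complex.Re `|x|.

Lemma rnormE x : (rnorm x)%:C = `|x|.
Proof. by rewrite /rnorm RRe_real// ger0_real. Qed.

Lemma rnorm_ge0 x : 0 <= rnorm x.
Proof. by rewrite -ler0c rnormE. Qed.

Lemma rnorm0 : rnorm 0 = 0.
Proof. by apply: complexI; rewrite rnormE normr0. Qed.

Lemma rnorm_eq0 x : (rnorm x == 0) = (x == 0).
Proof. by rewrite -(inj_eq (@complexI R)) rnormE normr_eq0. Qed.

Lemma rnormD x y : rnorm (x + y) <= rnorm x + rnorm y.
Proof. by rewrite -lecR raddfD/= !rnormE ler_normD. Qed.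

Lemma rnormN x : rnorm (- x) = rnorm x.
Proof. by rewrite /rnorm normrN. Qed.

Lemma rnormB x y : rnorm (x - y) = rnorm (y - x).
Proof. by rewrite /rnorm distrC. Qed.

Lemma rnormZ (a : R[i]) x : rnorm (a *: x) = complex.Re `|a| * rnorm x.
Proof.
apply: complexI; rewrite rmorphM !rnormE normrZ; congr (_ * _).
exact/esym/RRe_real/ger0_real.
Qed.

Lemma dist_rnorm x y : `|rnorm x - rnorm y| <= rnorm (x - y).
Proof.
rewrite ler_norml lerBrDr; apply/andP; split.
  rewrite addrC lerBlDr addrC; have := rnormD (y - x) x.
  by rewrite subrK rnormB addrC.
by rewrite lerBlDr; have := rnormD (x - y) y; rewrite subrK.
Qed.

End RealNorm.

Section BoundedOperators.
Variables (R : realType) (H K : normedModType R[i]).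

Definition bounded_linear (f : H -> K) : Prop :=
  linear f /\ exists c : R[i], forall x, `|f x| <= c * `|x|.

Definition bop_pred : {pred H -> K} := [pred f | `[< bounded_linear f >]].

Record bop := Bop { bop_fun :> H -> K ; _ : bop_fun \in bop_pred }.

HB.instance Definition _ := [isSub for bop_fun].
HB.instance Definition _ := [Choice of bop by <:].

Lemma bopP (T : bop) : bounded_linear T.
Proof. by case: T => f /= /asboolP. Qed.

Lemma bop_ext (S T : bop) : (forall x, S x = T x) -> S = T.
Proof. by move=> ST; apply/val_inj/funext. Qed.

Definition bop_of (f : H -> K) (hf : bounded_linear f) : bop :=
  @Bop f (introT (asboolP (bounded_linear f)) hf).

HB.instance Definition _ (T : bop) :=
  @GRing.isLinear.Build R[i] H K _ (bop_fun T) (bopP T).1.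

Lemma bop_submod_closed : submod_closed bop_pred.
Proof.
split.
  apply/asboolP; split; first by move=> a x y /=; rewrite scaler0 addr0.
  by exists 0 => x; rewrite normr0 mul0r.
move=> a f g /asboolP[lf [c fc]] /asboolP[lg [d gd]]; apply/asboolP; split.
  move=> b x y; rewrite !fctE lf lg !scalerDr !scalerA (mulrC b).
  by rewrite addrACA.
exists (`|a| * c + d) => x; rewrite mulrDl.
by rewrite (le_trans (ler_normD _ _))// lerD// normrZ -mulrA ler_wpM2l.
Qed.
HB.instance Definition _ := GRing.isSubmodClosed.Build _ _ bop_pred
  bop_submod_closed.
HB.instance Definition _ := [SubChoice_isSubLmodule of bop by <:].

End BoundedOperators.

Section OperatorNorm.
Variables (R : realType) (H K : normedModType R[i]).
Implicit Types S T : bop H K.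

Definition opnorm T : R := sup [set rnorm (T x) | x in [set x | rnorm x <= 1]].

Lemma opnorm_has_sup T :
  has_sup [set rnorm (T x) | x in [set x | rnorm x <= 1]].
Proof.
split; first by exists (rnorm (T 0)), 0 => //=; rewrite rnorm0.
have [_ [c cT]] := bopP T.
have [c0 | c0] := boolP (0 <= c); last first.
  exists 0 => _ [x /= x1 <-]; suff -> : T x = 0 by rewrite rnorm0.
  apply/eqP; rewrite -normr_le0.
  have [->|xN0] := eqVneq x 0; first by rewrite linear0 normr0.
  have := le_trans (normr_ge0 _) (cT x).
  by rewrite pmulr_lge0 ?normr_gt0// (negbTE c0).
exists (complex.Re c) => _ [x /= x1 <-].
rewrite -lecR rnormE RRe_real ?ger0_real//.
by rewrite (le_trans (cT x))// ler_piMr// -rnormE lecR.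
Qed.

Lemma opnorm_ge0 T : 0 <= opnorm T.
Proof.
apply: sup_upper_bound (opnorm_has_sup T) _ _; exists 0 => /=.
  by rewrite rnorm0.
by rewrite linear0 rnorm0.
Qed.

Lemma rnorm_bop_le T x : rnorm (T x) <= opnorm T * rnorm x.
Proof.
have [->|xN0] := eqVneq x 0; first by rewrite linear0 !rnorm0 mulr0.
have x0 : 0 < rnorm x by rewrite lt_neqAle rnorm_ge0 andbT eq_sym rnorm_eq0.
have nV : complex.Re `|((rnorm x)^-1)%:C : R[i]| = (rnorm x)^-1.
  by rewrite ger0_norm// ler0c invr_ge0 rnorm_ge0.
rewrite -ler_pdivrMr// mulrC -nV -rnormZ -linearZ.
apply: sup_upper_bound (opnorm_has_sup T) _ _.
by exists (((rnorm x)^-1)%:C *: x) => //=; rewrite rnormZ nV mulVf ?gt_eqF.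
Qed.

Lemma opnorm_le T c : 0 <= c -> (forall x, rnorm (T x) <= c * rnorm x) ->
  opnorm T <= c.
Proof.
move=> c0 cT; apply: ge_sup; first by have [] := opnorm_has_sup T.
by move=> _ [x /= x1 <-]; rewrite (le_trans (cT x))// ler_piMr.
Qed.

Let norm_bop T : R[i] := (opnorm T)%:C.

Let norm_bopD S T : norm_bop (S + T) <= norm_bop S + norm_bop T.
Proof.
rewrite -raddfD lecR opnorm_le ?addr_ge0 ?opnorm_ge0// => x.
by rewrite (le_trans (rnormD _ _))// mulrDl lerD ?rnorm_bop_le.
Qed.

Let opnormZ_le (a : R[i]) T : opnorm (a *: T) <= complex.Re `|a| * opnorm T.
Proof.
have a0 : 0 <= complex.Re `|a| by rewrite -ler0c RRe_real ?ger0_real.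
rewrite opnorm_le ?mulr_ge0 ?opnorm_ge0// => x.
by rewrite rnormZ -mulrA ler_wpM2l ?rnorm_bop_le.
Qed.

Let norm_bopZ (a : R[i]) T : norm_bop (a *: T) = `|a| * norm_bop T.
Proof.
have aE : (complex.Re `|a|)%:C = `|a| by rewrite RRe_real ?ger0_real.
rewrite /norm_bop -[in RHS]aE -rmorphM; congr (_%:C).
apply/eqP; rewrite eq_le opnormZ_le andTb.
have [->|aN0] := eqVneq a 0; first by rewrite normr0 mul0r opnorm_ge0.
have ra : 0 < complex.Re `|a| by rewrite -ltcR aE normr_gt0.
rewrite -ler_pdivlMl// -[in leLHS](scalerK aN0 T).
rewrite (le_trans (opnormZ_le _ _))//.
suff -> : complex.Re `|a^-1| = (complex.Re `|a|)^-1 by [].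
apply: complexI; rewrite fmorphV; transitivity (`|a|^-1).
  by rewrite normfV RRe_real ?ger0_real ?invr_ge0.
by congr (_^-1); exact: esym aE.
Qed.

Let norm_bop0_eq0 T : norm_bop T = 0 -> T = 0.
Proof.
move=> /complexI T0; apply: bop_ext => x; apply/eqP.
rewrite -rnorm_eq0 eq_le rnorm_ge0 andbT.
by rewrite (le_trans (rnorm_bop_le T x))// T0 mul0r.
Qed.

HB.instance Definition _ := Lmodule_isNormed.Build R[i] (bop H K)
  norm_bopD norm_bopZ norm_bop0_eq0.

Lemma bop_normE T : `|T| = (opnorm T)%:C.
Proof. by []. Qed.

End OperatorNorm.

Section Composition.
Variables (R : realType) (H K L : normedModType R[i]).

Lemma bounded_linear_comp (S : bop K L) (T : bop H K) :
  bounded_linear (fun x => S (T x)).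
Proof.
split; first by move=> a x y; rewrite !linearP.
exists (opnorm S * opnorm T)%:C => x.
rewrite -!rnormE -rmorphM lecR -mulrA (le_trans (rnorm_bop_le _ _))//.
by rewrite ler_wpM2l ?opnorm_ge0 ?rnorm_bop_le.
Qed.

Definition bop_comp S T : bop H L := bop_of (bounded_linear_comp S T).

End Composition.

Section PreHilbert.
Local Open Scope ring_scope.
Variables (R : realType) (V : lmodType R[i]) (f : {dot V for (@Num.conj R[i])}).
Implicit Types x y : V.

Lemma dot_cauchy_schwarz x y : `|f x y| ^+ 2 <= f x x * f y y.
Proof.
have [->|yN0] := eqVneq y 0.
  by rewrite !linear0r normr0 expr0n/= mulr0.
have n0 : 0 < f y y by rewrite dnorm_gt0.
set p := f x y; set n := f y y.
have nR : n \is Num.real by rewrite ger0_real ?ltW.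
have := dnorm_ge0 f (x - (p / n) *: y).
rewrite dnormB dnormZ linearZr_LR/= -/p -/n.
have -> : (p / n)^* * p = `|p| ^+ 2 / n.
  by rewrite rmorphM/= fmorphV/= (conj_Creal nR) mulrAC -normCKC.
have -> : (`|p| ^+ 2 / n)^* = `|p| ^+ 2 / n.
  by rewrite conj_Creal// realM ?realX ?realV ?normr_real.
rewrite normrM normfV (gtr0_norm n0) exprMn exprVn.
have -> : `|p| ^+ 2 * n ^- 2 * n = `|p| ^+ 2 / n.
  by rewrite expr2 invfM -!mulrA mulVf ?gt_eqF// mulr1.
by rewrite opprD addrACA subrr addr0 subr_ge0 ler_pdivrMr.
Qed.

Definition dot_norm x : R[i] := sqrtC (f x x).

Lemma dot_normD x y : dot_norm (x + y) <= dot_norm x + dot_norm y.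
Proof.
rewrite -(@ler_pXn2r _ 2)// ?nnegrE ?addr_ge0 ?sqrt_dnorm_ge0//.
rewrite sqrrD !sqrtCK dnormD -!addrA lerD2l (addrA (dot_norm x * _)) [leRHS]addrC lerD2l.
have -> : f x y + (f x y)^* = 'Re (f x y) *+ 2.
  by rewrite ReE -mulr_natr divfK ?pnatr_eq0.
rewrite -mulr2n lerMn2r/= (le_trans (leif_Re_Creal _))// -sqrtCM ?nnegrE ?dnorm_ge0//.
by rewrite -[leLHS]sqrCK// ler_sqrtC ?nnegrE ?exprn_ge0 ?mulr_ge0 ?dnorm_ge0// dot_cauchy_schwarz.
Qed.

Lemma dot_normZ (a : R[i]) x : dot_norm (a *: x) = `|a| * dot_norm x.
Proof.
by rewrite /dot_norm dnormZ sqrtCM ?nnegrE ?exprn_ge0 ?dnorm_ge0// sqrCK.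
Qed.

Lemma dot_norm0_eq0 x : dot_norm x = 0 -> x = 0.
Proof. by move/eqP; rewrite sqrt_dnorm_eq0 => /eqP. Qed.

End PreHilbert.

Section ComplexSeries.
Variable R : realType.
Implicit Types u v : nat -> R[i].

(* [csum_to u z] : the complex series of general term [u] converges to [z]. *)
Definition csum_to u (z : R[i]) : Prop :=
  (series (fun k => complex.Re (u k)) @ \oo --> complex.Re z) /\
  (series (fun k => complex.Im (u k)) @ \oo --> complex.Im z).

Lemma csum_toE u z : csum_to u z ->
  limn (series (fun k => complex.Re (u k)))
    +i* limn (series (fun k => complex.Im (u k))) = z.
Proof.
by case: z => a b [/= ua ub]; rewrite (cvg_lim _ ua)// (cvg_lim _ ub).
Qed.

Lemma norm_Re_le (z : R[i]) : `|complex.Re z| <= complex.Re `|z|.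
Proof.
rewrite normc_def/= -sqrtr_sqr; apply: ler_wsqrtr.
by rewrite lerDl sqr_ge0.
Qed.

Lemma norm_Im_le (z : R[i]) : `|complex.Im z| <= complex.Re `|z|.
Proof.
rewrite normc_def/= -sqrtr_sqr; apply: ler_wsqrtr.
by rewrite lerDr sqr_ge0.
Qed.

Lemma csum_to_cvg u (v : nat -> R) : (forall k, complex.Re `|u k| <= v k) ->
  cvgn (series v) -> exists z, csum_to u z.
Proof.
move=> uv sv; have u0 k : 0 <= complex.Re `|u k|.
  exact: le_trans (normr_ge0 _) (norm_Re_le (u k)).
have v0 k : 0 <= v k by exact: le_trans (u0 k) (uv k).
have cRe : cvgn (series (fun k => complex.Re (u k))).
  apply: (@normed_cvg _ R^o); apply: series_le_cvg sv => [k|k|k] //=.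
  exact: le_trans (norm_Re_le (u k)) (uv k).
have cIm : cvgn (series (fun k => complex.Im (u k))).
  apply: (@normed_cvg _ R^o); apply: series_le_cvg sv => [k|k|k] //=.
  exact: le_trans (norm_Im_le (u k)) (uv k).
by exists (limn (series (fun k => complex.Re (u k)))
   +i* limn (series (fun k => complex.Im (u k)))).
Qed.

Lemma csum_toD u v z w : csum_to u z -> csum_to v w ->
  csum_to (fun k => u k + v k) (z + w).
Proof.
move=> [u1 u2] [v1 v2]; split; rewrite raddfD/=.
  rewrite [X in X @ _](_ : _ = series (fun k => complex.Re (u k)) \+
    series (fun k => complex.Re (v k))); first exact: (@cvgD _ R^o).
  apply/funext => n; rewrite /series/= -big_split/=; apply: eq_bigr => k _.
  by rewrite raddfD.
rewrite [X in X @ _](_ : _ = series (fun k => complex.Im (u k)) \+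
  series (fun k => complex.Im (v k))); first exact: (@cvgD _ R^o).
apply/funext => n; rewrite /series/= -big_split/=; apply: eq_bigr => k _.
by rewrite raddfD.
Qed.

Lemma csum_toZ (a : R[i]) u z : csum_to u z ->
  csum_to (fun k => a * u k) (a * z).
Proof.
case: a z => a b [c d] [/= u1 u2]; split => /=.
  rewrite [X in X @ _](_ : _ = (fun n =>
      a * series (fun k => complex.Re (u k)) n -
      b * series (fun k => complex.Im (u k)) n)).
    by apply: (@cvgB _ R^o); apply: cvgMr.
  apply/funext => n; rewrite /series/= !mulr_sumr -sumrB.
  by apply: eq_bigr => k _; case: (u k).
rewrite [X in X @ _](_ : _ = (fun n =>
    a * series (fun k => complex.Im (u k)) n +
    b * series (fun k => complex.Re (u k)) n)).
  by apply: (@cvgD _ R^o); apply: cvgMr.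
apply/funext => n; rewrite /series/= !mulr_sumr -big_split/=.
by apply: eq_bigr => k _; case: (u k).
Qed.

Lemma csum_to_conj u z : csum_to u z -> csum_to (fun k => (u k)^*) z^*.
Proof.
case: z => c d [/= u1 u2]; split => /=.
  rewrite [X in X @ _](_ : _ = series (fun k => complex.Re (u k)))//.
  by congr series; apply/funext => k; case: (u k).
rewrite [X in X @ _](_ : _ = - series (fun k => complex.Im (u k))).
  exact: (@cvgN _ R^o).
by rewrite -seriesN; congr series; apply/funext => k; rewrite !fctE; case: (u k).
Qed.

Lemma csum_to_real (v : nat -> R) (l : R) : series v @ \oo --> l ->
  csum_to (fun k => (v k)%:C) l%:C.
Proof.
move=> vl; split => //=.
rewrite [X in X @ _](_ : _ = cst 0); first exact: cvg_cst.
by apply/funext => n; rewrite /series/= big1.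
Qed.

End ComplexSeries.

Section HilbertSum.
Variables (R : realType) (H : hilbertType R).
Implicit Types x y : nat -> H.

Definition square_summable x : Prop :=
  cvgn (series (fun k => rnorm (x k) ^+ 2)).

Definition ell2_pred : {pred nat -> H} := [pred x | `[< square_summable x >]].

(* The Hilbert sum of countably many copies of H. *)
Record ell2 := Ell2 { ell2_seq :> nat -> H ; _ : ell2_seq \in ell2_pred }.

HB.instance Definition _ := [isSub for ell2_seq].
HB.instance Definition _ := [Choice of ell2 by <:].

Lemma ell2P (x : ell2) : square_summable x.
Proof. by case: x => x /= /asboolP. Qed.

Lemma ell2_ext (x y : ell2) : (forall k, x k = y k) -> x = y.
Proof. by move=> xy; apply/val_inj/funext. Qed.

Lemma square_summable_le x (c : R) :
  (forall n, series (fun k => rnorm (x k) ^+ 2) n <= c) -> square_summable x.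
Proof.
move=> xc; apply: nondecreasing_is_cvgn.
  by apply: nondecreasing_series => // k _; rewrite sqr_ge0.
by exists c => _ [n _ <-].
Qed.

Lemma square_summableD x y : square_summable x -> square_summable y ->
  square_summable (x + y).
Proof.
move=> sx sy; pose v k := 2 * rnorm (x k) ^+ 2 + 2 * rnorm (y k) ^+ 2.
have vE : series v = (2 *: series (fun k => rnorm (x k) ^+ 2) : nat -> R^o) +
    (2 *: series (fun k => rnorm (y k) ^+ 2) : nat -> R^o).
  by rewrite -!seriesZ -seriesD.
apply: (@series_le_cvg _ _ v) => [k|k|k|].
- exact: sqr_ge0.
- by rewrite /v addr_ge0// mulr_ge0 ?sqr_ge0.
- rewrite /v fctE; apply: (@le_trans _ _ ((rnorm (x k) + rnorm (y k)) ^+ 2)).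
    by rewrite ler_pXn2r ?nnegrE ?addr_ge0 ?rnorm_ge0// rnormD.
  rewrite -subr_ge0 [leRHS](_ : _ = (rnorm (x k) - rnorm (y k)) ^+ 2).
    exact: sqr_ge0.
  by rewrite sqrrD sqrrB; ring.
- rewrite vE; apply: (@is_cvgD _ R^o); exact: is_cvgZl_tmp.
Qed.

Lemma square_summableZ (a : R[i]) x : square_summable x ->
  square_summable (a *: x).
Proof.
move=> sx; rewrite /square_summable.
rewrite [X in series X](_ : _ =
  (complex.Re `|a|) ^+ 2 *: ((fun k => rnorm (x k) ^+ 2) : nat -> R^o)).
  by rewrite seriesZ; exact: is_cvgZl_tmp.
by apply/funext => k; rewrite fctE rnormZ exprMn.
Qed.

Lemma ell2_submod_closed : submod_closed ell2_pred.
Proof.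
split.
  apply/asboolP; apply: (@square_summable_le _ 0) => n.
  by rewrite /series/= big1// => k _; rewrite rnorm0 expr0n.
move=> a x y /asboolP sx /asboolP sy; apply/asboolP.
by apply: square_summableD => //; exact: square_summableZ.
Qed.
HB.instance Definition _ := GRing.isSubmodClosed.Build _ _ ell2_pred
  ell2_submod_closed.
HB.instance Definition _ := [SubChoice_isSubLmodule of ell2 by <:].

End HilbertSum.

Section HilbertSumDot.
Variables (R : realType) (H : hilbertType R).
Implicit Types x y z : ell2 H.

Lemma hdot_rnorm (u : H) : hdot u u = (rnorm u ^+ 2)%:C.
Proof. by rewrite -hdot_norm rmorphXn; congr (_ ^+ 2); rewrite -rnormE. Qed.

Lemma hdot_le (u v : H) : complex.Re `|hdot u v| <= rnorm u * rnorm v.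
Proof.
rewrite -(@ler_pXn2r _ 2)// ?nnegrE ?mulr_ge0 ?rnorm_ge0//; last first.
  by rewrite -ler0c RRe_real ?ger0_real.
rewrite -lecR exprMn; have -> : ((rnorm u ^+ 2 * rnorm v ^+ 2)%:C =
    (rnorm u ^+ 2)%:C * (rnorm v ^+ 2)%:C :> R[i]) by exact: rmorphM.
rewrite -!hdot_rnorm.
have -> : (complex.Re `|hdot u v| ^+ 2)%:C = `|hdot u v| ^+ 2.
  transitivity ((complex.Re `|hdot u v|)%:C ^+ 2); first exact: rmorphXn.
  by rewrite RRe_real ?ger0_real.
exact: dot_cauchy_schwarz.
Qed.

(* The sum of the complex series of general term [hdot (x k) (y k)], computed
   on real and imaginary parts. *)
Definition ell2_dot x y : R[i] :=
  limn (series (fun k => complex.Re (hdot (x k) (y k))))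
  +i* limn (series (fun k => complex.Im (hdot (x k) (y k)))).

Lemma ell2_dot_to x y : csum_to (fun k => hdot (x k) (y k)) (ell2_dot x y).
Proof.
have [] := @csum_to_cvg _ (fun k => hdot (x k) (y k))
    (fun k => rnorm (x k) ^+ 2 + rnorm (y k) ^+ 2).
- move=> k; rewrite (le_trans (hdot_le _ _))//.
  have := sqr_ge0 (rnorm (x k) - rnorm (y k)); rewrite sqrrB.
  have := mulr_ge0 (rnorm_ge0 (x k)) (rnorm_ge0 (y k)).
  by set a := rnorm (x k); set b := rnorm (y k); lra.
- rewrite (_ : series _ = series (fun k => rnorm (x k) ^+ 2 : R^o) +
    series (fun k => rnorm (y k) ^+ 2 : R^o)).
    by apply: (@is_cvgD _ R^o); exact: ell2P.
  by rewrite -seriesD.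
- by move=> l xyl; rewrite /ell2_dot (csum_toE xyl).
Qed.

Lemma ell2_dotP x y l : csum_to (fun k => hdot (x k) (y k)) l ->
  ell2_dot x y = l.
Proof. exact: csum_toE. Qed.

Lemma ell2_dotC x y : ell2_dot x y = (-1) ^+ false * Num.conj (ell2_dot y x).
Proof.
rewrite expr0 mul1r; apply: ell2_dotP.
have := csum_to_conj (ell2_dot_to y x).
congr csum_to; apply/funext => k; rewrite [RHS]hermC.
by rewrite expr0 mul1r.
Qed.

Lemma ell2_dot_linearl y : scalar (ell2_dot^~ y).
Proof.
move=> a x z; apply: ell2_dotP.
have := csum_toD (csum_toZ a (ell2_dot_to x y)) (ell2_dot_to z y).
by congr csum_to; apply/funext => k; rewrite linearPl.
Qed.

Lemma ell2_dot_linearr x : linear_for (Num.conj \; *%R) (ell2_dot x).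
Proof.
move=> a y z; rewrite ell2_dotC ell2_dot_linearl expr0 mul1r rmorphD rmorphM.
by rewrite (ell2_dotC x y) (ell2_dotC x z) !expr0 !mul1r.
Qed.

HB.instance Definition _ := bilinear_isBilinear.Build R[i] (ell2 H) (ell2 H) R[i]
  *%R (Num.conj \; *%R) ell2_dot (ell2_dot_linearl, ell2_dot_linearr).
HB.instance Definition _ := isHermitianSesquilinear.Build R[i] (ell2 H) false
  Num.conj ell2_dot ell2_dotC.

Lemma ell2_dotE x : ell2_dot x x =
  (limn (series (fun k => rnorm (x k) ^+ 2)))%:C.
Proof.
apply: ell2_dotP; rewrite (_ : (fun k => _) = fun k => (rnorm (x k) ^+ 2)%:C).
  by apply: csum_to_real; exact: ell2P.
by apply/funext => k; rewrite hdot_rnorm.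
Qed.

Lemma ell2_series_le x n :
  series (fun k => rnorm (x k) ^+ 2) n <=
  limn (series (fun k => rnorm (x k) ^+ 2)).
Proof.
apply: nondecreasing_cvgn_le; last exact: ell2P.
by apply: nondecreasing_series => k _ _; rewrite sqr_ge0.
Qed.

Lemma ell2_dot_gt0 x : x != 0 -> 0 < ell2_dot x x.
Proof.
move=> xN0; rewrite ell2_dotE ltcR lt_neqAle; apply/andP; split; last first.
  by apply: le_trans (ell2_series_le x 0); rewrite /series/= big_geq.
apply: contra xN0 => /eqP x0; apply/eqP/ell2_ext => k.
apply/eqP; rewrite -rnorm_eq0 -sqrf_eq0 eq_le sqr_ge0 andbT x0.
apply: le_trans (ell2_series_le x k.+1).
by rewrite /series/= big_nat_recr//= lerDr sumr_ge0// => j _; rewrite sqr_ge0.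
Qed.

HB.instance Definition _ := isDotProduct.Build R[i] (ell2 H) ell2_dot
  ell2_dot_gt0.

HB.instance Definition _ := Lmodule_isNormed.Build R[i] (ell2 H)
  (dot_normD ell2_dot) (dot_normZ ell2_dot) (dot_norm0_eq0 (f := ell2_dot)).

Lemma ell2_normE x : `|x| ^+ 2 = ell2_dot x x.
Proof. exact: sqrtCK. Qed.

Lemma ell2_rnormE x :
  rnorm x ^+ 2 = limn (series (fun k => rnorm (x k) ^+ 2)).
Proof. by apply: complexI; rewrite -ell2_dotE -ell2_normE rmorphXn -rnormE. Qed.

End HilbertSumDot.

Section HilbertSumComplete.
Variables (R : realType) (H : hilbertType R).

Let rnorm_lt (V : normedModType R[i]) (u : V) (e : R) :
  (`|u| < e%:C) = (rnorm u < e).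
Proof. by rewrite -rnormE ltcR. Qed.

Let cvg_rnorm (T : Type) (F : set_system T) (FF : Filter F) (f : T -> H)
    (u l : H) :
  f @ F --> l -> (fun t => rnorm (u - f t)) @ F --> rnorm (u - l).
Proof.
move=> fl; apply/(@cvgrPdist_lt _ R^o) => e e0.
have e0' : 0 < e%:C :> R[i] by rewrite ltcR.
move/cvgrPdist_lt : fl => /(_ _ e0'); apply: filterS => t.
rewrite rnorm_lt => lt; apply: le_lt_trans (dist_rnorm _ _) _.
by rewrite opprB addrC addrA subrK rnormB.
Qed.

Lemma ell2_coord_le (x : ell2 H) k : rnorm (x k) <= rnorm x.
Proof.
rewrite -(@ler_pXn2r _ 2)// ?nnegrE ?rnorm_ge0// ell2_rnormE.
apply: le_trans (ell2_series_le x k.+1).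
by rewrite /series/= big_nat_recr//= lerDr sumr_ge0// => j _; rewrite sqr_ge0.
Qed.

Lemma ell2_complete (F : set_system (ell2 H)) :
  ProperFilter F -> cauchy F -> cvg F.
Proof.
move=> FF Fc; have Fe (e : R) : 0 < e ->
    exists2 A, F A & forall x y, A x -> A y -> rnorm (x - y) <= e.
  move=> e0; have e20 : 0 < (e / 2)%:C :> R[i] by rewrite ltcR divr_gt0.
  have [x0 Fx0] := (@cauchyP _ (ell2 H) F FF).1 Fc _ e20.
  exists (ball x0 (e / 2)%:C) => // x y; rewrite -!ball_normE/=.
  rewrite !rnorm_lt => x0x x0y.
  have -> : x - y = (x0 - y) - (x0 - x) by rewrite opprB [RHS]addrC addrA subrK.
  rewrite (le_trans (rnormD _ _))// rnormN (splitr e).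
  by rewrite lerD// ltW.
have /choice[l Fl] : forall k, exists lk : H, (fun x : ell2 H => x k) @ F --> lk.
  move=> k; apply/cvg_ex; apply: cauchy_cvg.
  apply: (@cauchy_exP _ H) => e e0.
  have eR : (complex.Re e)%:C = e by rewrite RRe_real ?ger0_real ?ltW.
  have e20 : 0 < complex.Re e / 2 by rewrite divr_gt0// -ltcR eR.
  have [A FA Ae] := Fe _ e20.
  have [a Aa] := filter_ex FA.
  exists (a k); rewrite /= /nbhs/=; apply: filterS FA => x Ax.
  rewrite /= -ball_normE/= -eR rnorm_lt.
  apply: le_lt_trans (ell2_coord_le (a - x) k) _.
  apply: le_lt_trans (Ae _ _ Aa Ax) _.
  by rewrite ltr_pdivrMr// ltr_pMr ?ltr1n// -ltcR eR.
have lim_le (e : R) (A : set (ell2 H)) : F A ->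
    (forall x y, A x -> A y -> rnorm (x - y) <= e) ->
    forall x, A x -> forall n,
      series (fun k => rnorm (x k - l k) ^+ 2) n <= e ^+ 2.
  move=> FA Ae x Ax n; have e0 : 0 <= e := le_trans (rnorm_ge0 _) (Ae x x Ax Ax).
  have cv : (fun y : ell2 H => series (fun k => rnorm (x k - y k) ^+ 2) n) @ F -->
      series (fun k => rnorm (x k - l k) ^+ 2) n.
    rewrite /series/=; elim: n => [|n IHn].
      rewrite big_geq//; under eq_fun do rewrite big_geq//; exact: cvg_cst.
    rewrite big_nat_recr//=; under eq_fun do rewrite big_nat_recr//=.
    apply: (@cvgD _ R^o _ _ _ _ _ _ _ IHn).
    by apply: (@cvgM R); exact: cvg_rnorm (Fl n).
  rewrite -(cvg_lim _ cv)//; apply: limr_le; first by apply/cvg_ex; eexists; exact: cv.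
  apply: filterS FA => y Ay.
  apply: le_trans (ell2_series_le (x - y) n) _.
  by rewrite -ell2_rnormE ler_pXn2r ?nnegrE ?rnorm_ge0// Ae.
have ls : square_summable l.
  have [A FA Ae] := Fe 1 ltr01; have [a Aa] := filter_ex FA.
  have -> : l = (a : nat -> H) + (fun k => (-1 : R[i]) *: (a k - l k)).
    apply/funext => k; change (l k = a k + (-1) *: (a k - l k)).
    by rewrite scaleN1r opprB [RHS]addrC subrK.
  apply: square_summableD; first exact: ell2P.
  apply: square_summableZ; apply: (@square_summable_le _ _ _ (1 ^+ 2)) => n.
  exact: (lim_le 1 A FA Ae a Aa n).
pose L : ell2 H := Ell2 (introT (asboolP (square_summable l)) ls).
apply/cvg_ex; exists L; apply/cvgrPdist_lt => e e0.
have eR : (complex.Re e)%:C = e by rewrite RRe_real ?ger0_real ?ltW.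
have re0 : 0 < complex.Re e by rewrite -ltcR eR.
have [A FA Ae] := Fe _ (divr_gt0 re0 (@ltr0Sn R 1)).
apply: filterS (FA) => x Ax; rewrite -eR rnorm_lt rnormB.
apply: (@le_lt_trans _ _ (complex.Re e / 2)); last first.
  by rewrite ltr_pdivrMr// ltr_pMr ?ltr1n.
rewrite -(@ler_pXn2r _ 2)// ?nnegrE ?rnorm_ge0//; last by rewrite divr_ge0// ltW.
rewrite ell2_rnormE; apply: limr_le; first exact: (@ell2P R H (x - L)).
by apply: nearW => n; exact: (lim_le _ A FA Ae x Ax n).
Qed.

HB.instance Definition _ := Uniform_isComplete.Build (ell2 H) ell2_complete.

HB.instance Definition _ := CompleteNormedModule_isHilbert.Build R (ell2 H)
  (@ell2_normE R H).

End HilbertSumComplete.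

Section OperatorSpaces.
Variables (R : realType).

Definition is_subspace (V : normedModType R[i]) (S : set V) : Prop :=
  S 0 /\ forall (a : R[i]) x y, S x -> S y -> S (a *: x + y).

Definition closed_span (V : normedModType R[i]) (S : set V) : set V :=
  closure (smallest (@is_subspace V) S).

Definition operator_space (H K : hilbertType R) (X : set (bop H K)) : Prop :=
  is_subspace X /\ closed X.

Definition is_adjoint (H K : hilbertType R) (T : bop H K) (S : bop K H) : Prop :=
  forall x y, hdot (T x) y = hdot x (S y).

Definition adj_set (H K : hilbertType R) (M : set (bop H K)) : set (bop K H) :=
  [set S | exists2 T, M T & is_adjoint T S].

Definition mul_set (H K L : hilbertType R)
    (M : set (bop K L)) (N : set (bop H K)) : set (bop H L) :=
  [set bop_comp S T | S in M & T in N].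

Definition TRO (H K : hilbertType R) (M : set (bop H K)) : Prop :=
  operator_space M /\ mul_set (mul_set M (adj_set M)) M `<=` M.

Definition strongly_TRO_equivalent_by (H1 H2 K1 K2 : hilbertType R)
    (X : set (bop K1 K2)) (Y : set (bop H1 H2))
    (M1 : set (bop H1 K1)) (M2 : set (bop H2 K2)) : Prop :=
  [/\ TRO M1, TRO M2,
      X = closed_span (mul_set (mul_set M2 Y) (adj_set M1)) &
      Y = closed_span (mul_set (mul_set (adj_set M2) X) M1)].

(* No norm bound is required of the sequence; in a C*-algebra it is automatic,
   by the uniform boundedness principle. *)
Definition has_countable_approximate_identity (H : hilbertType R)
    (A : set (bop H H)) : Prop :=
  exists e : nat -> bop H H, (forall n, A (e n)) /\
    forall a, A a ->
      (bop_comp (e n) a @[n --> \oo] --> a) /\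
      (bop_comp a (e n) @[n --> \oo] --> a).

(* The norm of a matrix of operators, seen as an operator between the n-fold
   Hilbert sums of H and K. *)
Definition mx_opnorm (H K : hilbertType R) n (A : 'M[bop H K]_n) : R :=
  sup [set Num.sqrt (\sum_i rnorm (\sum_j A i j (x j)) ^+ 2)
       | x in [set x : 'I_n -> H | \sum_j rnorm (x j) ^+ 2 <= 1]].

Definition completely_isometrically_isomorphic (H1 H2 K1 K2 : hilbertType R)
    (X : set (bop K1 K2)) (Y : set (bop H1 H2)) : Prop :=
  exists phi : bop K1 K2 -> bop H1 H2,
    [/\ forall (a : R[i]) S T, X S -> X T ->
          phi (a *: S + T) = a *: phi S + phi T,
        phi @` X = Y &
        forall n (A : 'M[bop K1 K2]_n), (forall i j, X (A i j)) ->
          mx_opnorm (map_mx phi A) = mx_opnorm A].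

(* The operators between the countable Hilbert sums whose matrix is finitely
   supported, with entries in X. *)
Definition finitely_supported (K1 K2 : hilbertType R) (X : set (bop K1 K2)) :
    set (bop (ell2 K1) (ell2 K2)) :=
  [set T : bop (ell2 K1) (ell2 K2) | exists n (A : 'M[bop K1 K2]_n),
    [/\ forall i j, X (A i j),
        forall (xi : ell2 K1) (i : 'I_n), T xi i = \sum_j A i j (xi j) &
        forall (xi : ell2 K1) k, (n <= k)%N -> T xi k = 0]].

Definition Kinfty (K1 K2 : hilbertType R) (X : set (bop K1 K2)) :
    set (bop (ell2 K1) (ell2 K2)) :=
  closure (finitely_supported X).

Definition stably_isomorphic (H1 H2 K1 K2 : hilbertType R)
    (X : set (bop K1 K2)) (Y : set (bop H1 H2)) : Prop :=
  completely_isometrically_isomorphic (Kinfty X) (Kinfty Y).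

End OperatorSpaces.

(* Main.v *)
Require Import Defs.
From mathcomp Require Import all_boot all_order all_algebra sesquilinear.
From mathcomp Require Import all_classical all_reals.
From mathcomp Require Import topology normedtype sequences interval_inference.
From mathcomp Require Import complex ring lra.

(** For a TRO [M] with coefficient algebras [A = [M M^*]] and [C = [M^* M]] that
    have countable approximate identities we build a partial isometry [U]
    between the Hilbert sums with [U K(C) <= K(M)], [U^* K(M) <= K(C)], such that
    [U^* U] and [U U^*] act as the identity on [K(C)] and [K(M)] respectively
    (the Brown-Green-Rieffel theorem). The isomorphism is then
    [x |-> U_2^* x U_1].

    [U] is the partial isometry of a polar decomposition of a single operator
    [T] in [K(M)] for which [T K(C)] is dense in [K(M)] and [T^* K(M)] is dense in
    [K(C)]. The approximate identities yield a sequence [eta] in [M] such that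
    [eta C] spans [M] and [eta^* M] spans [C]; one takes the symmetric matrix
    [T = \sum_k w_k eta_(s k) (E_(r k, k) + E_(k, r k))], where [(r k, s k)] runs
    infinitely often through all pairs and the weights [w] decay so fast that
    the column of index [k] is nearly proportional to [eta_(s k)] placed in row
    [r k]. *)

Set Implicit Arguments.
Unset Strict Implicit.
Unset Printing Implicit Defensive.

Import Order.TTheory GRing.Theory Num.Theory.
Import numFieldNormedType.Exports.

Local Open Scope classical_set_scope.
Local Open Scope ring_scope.
Local Open Scope complex_scope.

(** * Norm topology and Hilbert spaces *)

(** In general [U] is not an element of K(M), only a multiplier, so every statement about it says
    that multiplication by [U] or [U^*] carries one space into another. Such a [U] needs density.
    The positive part [P] of the polar decomposition of an element of K(M) always preserves K(C),
    but [U] is controlled only on products [P ** c], where [U ** P = T]; these products fill K(C) up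
    to closure exactly because both ranges of [T] are dense. In general [M] itself contains no
    element with both densities. K(M) leaves room to put countably many elements of [M] into
    different columns. Once U_1 and U_2 exist, the complete isometry is immediate: the inverse y |->
    U_2 y U_1^* has the same form, and both maps multiply by fixed contractions on either side. *)

Section RnormTopology.
Variables (R : realType) (V : normedModType R[i]).
Implicit Types (S : set V) (u : nat -> V).

Let posC_Re (e : R[i]) : 0 < e -> (complex.Re e)%:C = e /\ 0 < complex.Re e.
Proof.
move=> e0; have eE : (complex.Re e)%:C = e by rewrite RRe_real ?ger0_real ?ltW.
by split => //; rewrite -ltcR eE.
Qed.

Lemma rnorm_closureP S z : closure S z <->
  forall e : R, 0 < e -> exists2 s, S s & rnorm (z - s) < e.
Proof.
split=> [Sz e e0 | Sz B /nbhs_ballP[e /= e0 eB]].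
  have eC : 0 < e%:C :> R[i] by rewrite ltcR.
  have [s [Ss]] := Sz _ (nbhsx_ballx z _ eC).
  by rewrite -ball_normE/= -rnormE ltcR => zs; exists s.
have [eE re0] := posC_Re e0.
have [s Ss zs] := Sz _ re0; exists s; split => //; apply: eB.
by rewrite -ball_normE/= -rnormE -eE ltcR.
Qed.

Lemma rnorm_cvgnP u l : u n @[n --> \oo] --> l <->
  forall e : R, 0 < e -> exists N, forall n, (N <= n)%N -> rnorm (l - u n) < e.
Proof.
split=> [/cvgrPdist_lt ul e e0 | ul].
  have eC : 0 < e%:C :> R[i] by rewrite ltcR.
  have [N _ Nu] := ul _ eC; exists N => n /Nu/=.
  by rewrite -rnormE ltcR.
apply/cvgrPdist_lt => e e0; have [eE re0] := posC_Re e0.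
have [N Nu] := ul _ re0; exists N => // n /= /Nu.
by rewrite -rnormE -eE ltcR.
Qed.

End RnormTopology.

Section Complete.
Variables (R : realType).

Definition rcauchy (V : normedModType R[i]) (u : nat -> V) : Prop :=
  forall e : R, 0 < e -> exists N, forall n, (N <= n)%N -> rnorm (u N - u n) < e.

Definition rconv (V : normedModType R[i]) (u : nat -> V) (l : V) : Prop :=
  forall e : R, 0 < e -> exists N, forall n, (N <= n)%N -> rnorm (l - u n) < e.

Lemma rcauchy_rconv (V : completeNormedModType R[i]) (u : nat -> V) :
  rcauchy u -> exists l, rconv u l.
Proof.
move=> uc; suff: cvg (u n @[n --> \oo]).
  by move=> /cvg_ex[l ul]; exists l; apply/rnorm_cvgnP.
apply: cauchy_cvg; apply: (@cauchy_exP _ V) => e e0.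
have eE : (complex.Re e)%:C = e by rewrite RRe_real ?ger0_real ?ltW.
have re0 : 0 < complex.Re e by rewrite -ltcR eE.
have [N Nu] := uc _ re0.
exists (u N); exists N => // n /= /Nu.
by rewrite -ball_normE/= -rnormE -eE ltcR.
Qed.

Lemma rconv_le (V : normedModType R[i]) (u : nat -> V) l z c N :
  rconv u l -> (forall n, (N <= n)%N -> rnorm (u n - z) <= c) ->
  rnorm (l - z) <= c.
Proof.
move=> ul uc; apply/ler_addgt0Pr => e e0.
have [M Mu] := ul _ e0; pose n := maxn M N.
rewrite -(subrK (u n) l) -addrA addrC.
rewrite (le_trans (rnormD _ _))// lerD ?uc ?leq_maxr// ltW// Mu// leq_maxl//.
Qed.

Lemma telescope_le (V : normedModType R[i]) (u : nat -> V) (v : nat -> R) m n :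
  (forall k, rnorm (u k.+1 - u k) <= v k.+1 - v k) -> (m <= n)%N ->
  rnorm (u n - u m) <= v n - v m.
Proof.
move=> uv; elim: n => [|n IHn].
  by rewrite leqn0 => /eqP ->; rewrite !subrr rnorm0.
rewrite leq_eqVlt => /predU1P[->|]; first by rewrite !subrr rnorm0.
rewrite ltnS => /IHn mn; rewrite -(subrK (u n) (u n.+1)) -addrA.
by rewrite (le_trans (rnormD _ _))// -(subrK (v n) (v n.+1)) -addrA lerD.
Qed.

(** Norms are nonnegative, so [v] is nondecreasing; past an index where [v] is within [e] of its
    supremum, the telescoped increments of [u] stay below [e]. This serves both the square root
    iteration and the partial sums [spread]. *)
Lemma rcauchy_telescope (V : normedModType R[i]) (u : nat -> V) (v : nat -> R) c :
  (forall k, rnorm (u k.+1 - u k) <= v k.+1 - v k) -> (forall k, v k <= c) ->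
  rcauchy u.
Proof.
move=> uv vc e e0; have vsup : has_sup (range v).
  split; first by exists (v 0), 0%N.
  by exists c => _ [n _ <-].
have [_ [N _ <-] Ne] := sup_adherent e0 vsup; exists N => n Nn.
rewrite rnormB (le_lt_trans (telescope_le uv Nn))//.
have : v n <= sup (range v) by apply: sup_upper_bound => //; exists n.
move: Ne; lra.
Qed.

Lemma rconv_unique (V : normedModType R[i]) (u : nat -> V) l l' :
  rconv u l -> rconv u l' -> l = l'.
Proof.
move=> ul ul'; apply/eqP; rewrite -subr_eq0 -rnorm_eq0 eq_le rnorm_ge0 andbT.
apply/ler_addgt0Pr => e e0; rewrite add0r.
have [N Nu] := ul' _ e0; apply: (@rconv_le _ u _ _ _ N) => // n /Nu /ltW.
by rewrite rnormB.
Qed.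

Lemma rconv_map (V W : normedModType R[i]) (f : V -> W) (c : R) u l :
  (forall x y, rnorm (f x - f y) <= c * rnorm (x - y)) ->
  rconv u l -> rconv (f \o u) (f l).
Proof.
move=> fc ul e e0.
have c1 : 0 < `|c| + 1 by rewrite ltr_wpDl.
have [N Nu] := ul (e / (`|c| + 1)) (divr_gt0 e0 c1).
exists N => n /Nu; rewrite ltr_pdivlMr// => ue.
apply: le_lt_trans ue; rewrite (le_trans (fc _ _))// mulrC ler_wpM2l ?rnorm_ge0//.
by rewrite (le_trans (ler_norm _))// lerDl.
Qed.

Lemma rconvD (V : normedModType R[i]) (u v : nat -> V) l m :
  rconv u l -> rconv v m -> rconv (fun n => u n + v n) (l + m).
Proof.
move=> ul vm e e0; have e2 : 0 < e / 2 by rewrite divr_gt0.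
have [N Nu] := ul _ e2; have [M Mv] := vm _ e2.
exists (maxn N M) => n; rewrite geq_max => /andP[Nn Mn].
rewrite opprD addrACA (le_lt_trans (rnormD _ _))// (splitr e) ltrD//.
  exact: Nu.
exact: Mv.
Qed.

Lemma rconvZ (V : normedModType R[i]) (a : R[i]) (u : nat -> V) l :
  rconv u l -> rconv (fun n => a *: u n) (a *: l).
Proof.
apply: (@rconv_map _ _ _ (complex.Re `|a|)) => x y.
by rewrite -scalerBr rnormZ.
Qed.

Lemma rconv_cst (V : normedModType R[i]) (l : V) : rconv (fun=> l) l.
Proof. by move=> e e0; exists 0%N => n _; rewrite subrr rnorm0. Qed.

Lemma natSinv_lt (e : R) : 0 < e ->
  exists N, forall n, (N <= n)%N -> n.+1%:R^-1 < e.
Proof.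
by move=> e0; have [N _ Ne] := near_infty_natSinv_lt (PosNum e0); exists N.
Qed.

Lemma closure_rconv (V : normedModType R[i]) (S : set V) z :
  closure S z -> exists2 u : nat -> V, (forall n, S (u n)) & rconv u z.
Proof.
move=> /rnorm_closureP Sz.
have /choice[u uP] n : exists s, S s /\ rnorm (z - s) < n.+1%:R^-1.
  by have [|s] := Sz (n.+1%:R^-1); [rewrite invr_gt0|exists s].
exists u => [n|e e0]; first by have [] := uP n.
have [N Ne] := natSinv_lt e0.
by exists N => n /Ne; apply: lt_trans; have [] := uP n.
Qed.

Lemma closed_rconv (V : normedModType R[i]) (S : set V) (u : nat -> V) z :
  closed S -> (forall n, S (u n)) -> rconv u z -> S z.
Proof.
move=> Sc Su uz; apply: Sc; apply/rnorm_closureP => e /uz[N Nu].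
by exists (u N); rewrite ?Nu.
Qed.

End Complete.

Section Hdot.
Variables (R : realType) (H : hilbertType R).
Implicit Types x y z : H.

Lemma hdotC x y : hdot x y = Num.conj (hdot y x).
Proof. by rewrite (hermC hdot) expr0 mul1r. Qed.

Let Re_realZ (t : R) (z : R[i]) : complex.Re (t%:C * z) = t * complex.Re z.
Proof. by case: z => a b /=; rewrite mul0r subr0. Qed.

Definition rdot x y : R := complex.Re (hdot x y).

Lemma rdotC x y : rdot x y = rdot y x.
Proof. by rewrite /rdot hdotC; case: (hdot y x). Qed.

Lemma rdotDl x y z : rdot (x + y) z = rdot x z + rdot y z.
Proof. by rewrite /rdot linearDl raddfD. Qed.

Lemma rdotDr x y z : rdot x (y + z) = rdot x y + rdot x z.
Proof. by rewrite /rdot linearDr raddfD. Qed.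

Lemma rdotBl x y z : rdot (x - y) z = rdot x z - rdot y z.
Proof. by rewrite /rdot linearBl raddfB. Qed.

Lemma rdotBr x y z : rdot x (y - z) = rdot x y - rdot x z.
Proof. by rewrite /rdot linearBr raddfB. Qed.

Lemma rdotNl x y : rdot (- x) y = - rdot x y.
Proof. by rewrite /rdot linearNl raddfN. Qed.

Lemma rdotZl (t : R) x y : rdot (t%:C *: x) y = t * rdot x y.
Proof. by rewrite /rdot linearZl_LR/= Re_realZ. Qed.

Lemma rdotZr (t : R) x y : rdot x (t%:C *: y) = t * rdot x y.
Proof. by rewrite rdotC rdotZl rdotC. Qed.

Lemma rdotE x : rdot x x = rnorm x ^+ 2.
Proof. by rewrite /rdot hdot_rnorm. Qed.

(** Taking 1 and then i for [a] recovers real and imaginary parts. This brings the real functionals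
    of [riesz_range] back to complex inner products. *)
Lemma rdot_ext (K : hilbertType R) x y (x' y' : K) :
  (forall a : R[i], rdot (a *: x) y = complex.Re (a * hdot x' y')) ->
  hdot x y = hdot x' y'.
Proof.
move=> xy; have := xy 1; have := xy (0 +i* 1).
rewrite scale1r mul1r /rdot linearZl_LR/=.
case: (hdot x y) => a b; case: (hdot x' y') => c d /=.
by rewrite !mul0r !mul1r !sub0r => /oppr_inj -> ->.
Qed.

Lemma rdot_le x y : rdot x y <= rnorm x * rnorm y.
Proof.
by rewrite (le_trans _ (hdot_le x y))// (le_trans (ler_norm _))// norm_Re_le.
Qed.

Lemma sqr_rnormD x y :
  rnorm (x + y) ^+ 2 = rnorm x ^+ 2 + 2 * rdot x y + rnorm y ^+ 2.
Proof. by rewrite -!rdotE rdotDl !rdotDr (rdotC y x); ring. Qed.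

Lemma sqr_rnormB x y :
  rnorm (x - y) ^+ 2 = rnorm x ^+ 2 - 2 * rdot x y + rnorm y ^+ 2.
Proof. by rewrite -!rdotE rdotBl !rdotBr (rdotC y x); ring. Qed.

Lemma hdot_inj x y : (forall z, hdot z x = hdot z y) -> x = y.
Proof.
move=> xy; apply/eqP; rewrite -subr_eq0 -rnorm_eq0 -sqrf_eq0 -rdotE.
by rewrite /rdot linearBr/= !xy subrr.
Qed.

End Hdot.

(** * Riesz representation and Douglas factorisation *)

Section Riesz.
Variables (R : realType) (H : hilbertType R).

(* The minimising sequence of [|P x|^2 - 2 g x] is mapped by [P] to a Cauchy
   sequence, by the parallelogram identity. For [P] the identity this is the
   Riesz representation theorem. *)
Lemma riesz_range (V : lmodType R[i]) (P : {linear V -> H}) (g : V -> R)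
    (c : R) :
  (forall x y, g (x + y) = g x + g y) ->
  (forall (t : R) x, g (t%:C *: x) = t * g x) ->
  (forall x, g x <= c * rnorm (P x)) ->
  exists2 z, closure (range P) z & forall x, g x = rdot (P x) z.
Proof.
move=> gD gZ gc; pose q x := rnorm (P x) ^+ 2 - 2 * g x.
have gN x : g (- x) = - g x.
  by apply/eqP; rewrite -addr_eq0 addrC -gD subrr -(scale0r 0) (gZ 0) mul0r.
have q_ge x : - c ^+ 2 <= q x.
  rewrite -subr_ge0 /q opprK; apply: le_trans (sqr_ge0 (rnorm (P x) - c)) _.
  by rewrite sqrrB; have := gc x; lra.
have q_inf : has_inf (range q).
  split; first by exists (q 0), 0.
  by exists (- c ^+ 2) => _ [x _ <-].
pose I := inf (range q).
have Iq x : I <= q x by apply: ge_inf; [exact: q_inf.2|exists x].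
have /choice[u uI] n : exists x, q x < I + n.+1%:R^-1.
  have n0 : 0 < n.+1%:R^-1 :> R by rewrite invr_gt0.
  by have [_ [x _ <-] qx] := inf_adherent n0 q_inf; exists x.
have qD x y (t : R) : q (x + t%:C *: y) =
    q x + t ^+ 2 * rnorm (P y) ^+ 2 + 2 * t * (rdot (P x) (P y) - g y).
  rewrite /q linearD linearZ sqr_rnormD gD gZ rdotZr -!rdotE rdotZl rdotZr.
  ring.
have sqB x y : rnorm (P x - P y) ^+ 2 <= 2 * q x + 2 * q y - 4 * I.
  (* At the midpoint of [x] and [y] the value of [q] is (q x + q y)/2 - |P x - P y|^2/4. *)
  have := Iq (x + (1 / 2)%:C *: (y - x)); rewrite qD gD gN linearB.
  rewrite /q -!rdotE !(rdotBl, rdotBr) (rdotC (P y) (P x)).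
  rewrite (_ : (1 / 2) ^+ 2 = 1 / 4 :> R); [lra|by field].
have uc : rcauchy (P \o u).
  move=> e e0; have e4 : 0 < e ^+ 2 / 4 by rewrite divr_gt0 ?exprn_gt0.
  have [N Ne] := natSinv_lt e4.
  exists N => n Nn /=; rewrite -(@ltr_pXn2r _ 2)// ?nnegrE ?rnorm_ge0 ?ltW//.
  apply: le_lt_trans (sqB _ _) _.
  have := Ne N (leqnn _); have := Ne n Nn.
  have := uI N; have := uI n; move: (_^-1) (_^-1) (q _) (q _) => a b p r.
  move: (e ^+ 2) => s; clearbody I; clear; lra.
have [z uz] := rcauchy_rconv uc; exists z.
  apply/rnorm_closureP => e /uz[N Nu].
  by exists (P (u N)); [exists (u N)|exact: Nu].
have ge x : 0 <= rdot (P x) z - g x.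
  (* First-order condition at the minimum: [I] is at most q(u_n + t x), and letting n grow leaves a
     nonnegative quadratic in [t] with linear coefficient 2 d. *)
  set d := _ - _; have td (t : R) : 0 < t -> 0 <= t ^+ 2 * rnorm (P x) ^+ 2 + 2 * t * d.
    move=> t0; apply/ler_addgt0Pr => e e0.
    have e2 : 0 < e / 2 by rewrite divr_gt0.
    pose r := 2 * t * rnorm (P x) + 1.
    have r0 : 0 < r by rewrite ltr_wpDl// !mulr_ge0 ?rnorm_ge0// ltW.
    have [N Ne] := natSinv_lt e2.
    have [M Mz] := uz _ (divr_gt0 e2 r0).
    pose n := maxn N M; have en := Ne n (leq_maxl _ _).
    have := Mz n (leq_maxr _ _); rewrite /= ltr_pdivlMr// => zn.
    have := Iq (u n + t%:C *: x); rewrite qD => In.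
    have := rdot_le (P x) (P (u n) - z); rewrite rdotBr rnormB => cs.
    have /(ler_wpM2l (ltW t0)) cst := cs.
    have zr : t * (rnorm (P x) * rnorm (z - P (u n))) * 2 <=
        rnorm (z - P (u n)) * r.
      rewrite -subr_ge0 (_ : _ - _ = rnorm (z - P (u n))) ?rnorm_ge0// /r.
      ring.
    have := uI n; rewrite (rdotC (P (u n))) in In.
    rewrite /d; move: cst In en zr zn.
    clearbody I r; clear; move: (_^-1) (q _) => a p.
    lra.
  rewrite leNgt; apply/negP => d0.
  pose N := rnorm (P x) ^+ 2; have N0 : 0 <= N by rewrite sqr_ge0.
  have N1 : 0 < N + 1 by rewrite ltr_wpDl.
  (* The quadratic is smallest at t = - d / N; [N + 1] keeps the choice meaningful when P x = 0 and
     still gives a negative value. *)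
  have t0 : 0 < - d / (N + 1) by rewrite divr_gt0// oppr_gt0.
  have := td _ t0; rewrite -/N.
  rewrite [leRHS](_ : _ = - d / (N + 1) * (d + d / (N + 1))); last first.
    by field; rewrite gt_eqF.
  rewrite pmulr_rge0// leNgt => /negP; apply.
  have : d / (N + 1) < 0 by rewrite pmulr_llt0 ?invr_gt0.
  lra.
move=> x; apply/eqP; rewrite eq_le -subr_ge0 ge andTb.
by have := ge (- x); rewrite linearN rdotNl gN; lra.
Qed.

End Riesz.

Section Factorisation.
Variables (R : realType) (L H K : hilbertType R).

Lemma closure_range_ortho (P : bop L H) z :
  closure (range P) z -> (forall x, hdot (P x) z = 0) -> z = 0.
Proof.
move=> Pz oz; apply/eqP; rewrite -rnorm_eq0 eq_le rnorm_ge0 andbT.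
apply/ler_addgt0Pr => e e0; rewrite add0r.
have [_ [x _ <-] ze] := (rnorm_closureP _ _).1 Pz _ e0.
rewrite (le_trans _ (ltW ze))// -(@ler_pXn2r _ 2)// ?nnegrE ?rnorm_ge0//.
rewrite rnormB sqr_rnormB /rdot oz/= mulr0 subr0 lerDr.
exact: sqr_ge0.
Qed.

(** Douglas' lemma: the estimate gives T = V^* P. It is stated through inner products because
    adjoints are obtained from it, with the identity for [P]. With a positive square root for [P] it
    gives the polar decomposition. Confining the range of [V] to the closure of the range of [P]
    makes [V] unique, hence linear. *)
Lemma factor_adjoint (P : bop L H) (T : bop L K) (c : R) : 0 <= c ->
  (forall x, rnorm (T x) <= c * rnorm (P x)) ->
  exists V : bop K H,
    [/\ forall x w, hdot (T x) w = hdot (P x) (V w),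
        forall w, closure (range P) (V w) &
        forall w, rnorm (V w) <= c * rnorm w].
Proof.
move=> c0 TP.
have /choice[v vP] w : exists z, closure (range P) z /\
    forall x, hdot (T x) w = hdot (P x) z.
  have [|||z Pz zw] := @riesz_range _ _ _ P (fun x => rdot (T x) w)
    (c * rnorm w).
  - by move=> x y; rewrite linearD rdotDl.
  - by move=> t x; rewrite linearZ rdotZl.
  - move=> x; rewrite (le_trans (rdot_le _ _))// mulrAC.
    by rewrite ler_wpM2r ?rnorm_ge0.
  exists z; split => // x; apply: rdot_ext => a.
  by rewrite -linearZ zw /rdot linearZ/= linearZl_LR.
have v_le w : rnorm (v w) <= c * rnorm w.
  have [Pv vw] := vP w.
  have cw : 0 <= c * rnorm w by rewrite mulr_ge0 ?rnorm_ge0.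
  have [u uP uv] := closure_rconv Pv.
  have le n : rdot (u n) (v w) <= c * rnorm w * rnorm (u n).
    have [x _ <-] := uP n; rewrite /rdot -vw -/(rdot _ _).
    rewrite (le_trans (rdot_le _ _))// mulrAC.
    by rewrite ler_wpM2r ?rnorm_ge0.
  (* Let a = |v w|, s = c |w| and b = |v w - u_N|. The bounds give a^2 <= a b + s (a + b), that is a
     (a - s) <= b (a + s), which is impossible if s < a and b < (a - s)/2. *)
  rewrite leNgt; apply/negP => lt.
  have d0 : 0 < rnorm (v w) by exact: le_lt_trans cw lt.
  have e0 : 0 < (rnorm (v w) - c * rnorm w) / 2.
    by rewrite divr_gt0// subr_gt0.
  have [N Nu] := uv _ e0; have := Nu N (leqnn _); have := le N.
  have := rdot_le (v w - u N) (v w); rewrite rdotBl rdotE.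
  have := rnormD (u N - v w) (v w); rewrite subrK (rnormB (u N)).
  set a := rnorm (v w); set b := rnorm (v w - u N); set s := c * rnorm w.
  have b0 : 0 <= b by exact: rnorm_ge0.
  move=> h1 h2 h3; have := ler_wpM2l cw h1; rewrite -/s.
  move: cw lt d0; rewrite -/a -/s => s0 sa a0.
  nra.
(* The defect of linearity lies in the closure of the range of [P] and is orthogonal to that
   range. *)
have v_lin : linear v.
  move=> a x y; apply/eqP; rewrite -subr_eq0; apply/eqP.
  have mem w : closure (range P) (v w) by have [] := vP w.
  apply: (@closure_range_ortho P).
    have [s sP sv] := closure_rconv (mem (a *: x + y)).
    have [s1 s1P s1v] := closure_rconv (mem x).
    have [s2 s2P s2v] := closure_rconv (mem y).
    apply/rnorm_closureP => e e0.
    have cv := rconvD sv (rconvZ (-1) (rconvD (rconvZ a s1v) s2v)).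
    rewrite -scaleN1r; have [N Ne] := cv _ e0.
    exists (s N + -1 *: (a *: s1 N + s2 N)); last exact: Ne.
    have [p _ <-] := sP N; have [p1 _ <-] := s1P N; have [p2 _ <-] := s2P N.
    by exists (p + -1 *: (a *: p1 + p2)) => //; rewrite linearD linearZ linearP.
  move=> p; rewrite linearBr/= linearPr/= -!(vP _).2 linearPr/=.
  exact: subrr.
have vb : bounded_linear v.
  by split=> //; exists c%:C => w; rewrite -!rnormE -rmorphM lecR.
by exists (bop_of vb); split => // [x w|w]; have [] := vP w.
Qed.

End Factorisation.

(** * Bounded operators and adjoints *)

Notation "S ** T" := (bop_comp S T) (at level 40, left associativity).

Section BopAlgebra.
Variables (R : realType) (G H K : normedModType R[i]).

Lemma bop_compE (S : bop H K) (T : bop G H) x : (S ** T) x = S (T x).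
Proof. by []. Qed.

Lemma bopD (S T : bop H K) x : (S + T) x = S x + T x. Proof. by []. Qed.
Lemma bopB (S T : bop H K) x : (S - T) x = S x - T x. Proof. by []. Qed.
Lemma bopZ a (T : bop H K) x : (a *: T) x = a *: T x. Proof. by []. Qed.
Lemma bop0 x : (0 : bop H K) x = 0. Proof. by []. Qed.

Lemma bop_sum I (r : seq I) (P : pred I) (F : I -> bop H K) x :
  (\sum_(i <- r | P i) F i) x = \sum_(i <- r | P i) F i x.
Proof. by elim/big_rec2: _ => // i y S _ <-. Qed.

Lemma rnorm_bop_apply (T : bop H K) x : rnorm (T x) <= rnorm T * rnorm x.
Proof. exact: rnorm_bop_le. Qed.

Lemma rnorm_bop_bound (T : bop H K) c : 0 <= c ->
  (forall x, rnorm (T x) <= c * rnorm x) -> rnorm T <= c.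
Proof. exact: opnorm_le. Qed.

End BopAlgebra.

Section Identity.
Variables (R : realType) (H : normedModType R[i]).

Lemma bounded_linear_id : bounded_linear (@id H).
Proof. by split => //; exists 1 => x; rewrite mul1r. Qed.

Definition bop1 : bop H H := bop_of bounded_linear_id.

End Identity.

Arguments bop1 {R H}.

Section BopComp.
Variables (R : realType) (G H K L : normedModType R[i]).

Lemma bop_compA (S : bop K L) (T : bop H K) (U : bop G H) :
  S ** (T ** U) = S ** T ** U.
Proof. exact: bop_ext. Qed.

Lemma bop_compDl (S T : bop H K) (U : bop G H) : (S + T) ** U = S ** U + T ** U.
Proof. exact: bop_ext. Qed.

Lemma bop_compBl (S T : bop H K) (U : bop G H) : (S - T) ** U = S ** U - T ** U.
Proof. exact: bop_ext. Qed.

Lemma bop_compZl a (S : bop H K) (U : bop G H) : (a *: S) ** U = a *: (S ** U).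
Proof. exact: bop_ext. Qed.

Lemma bop_compDr (S : bop H K) (T U : bop G H) : S ** (T + U) = S ** T + S ** U.
Proof. by apply: bop_ext => x; rewrite bopD !bop_compE bopD linearD. Qed.

Lemma bop_compBr (S : bop H K) (T U : bop G H) : S ** (T - U) = S ** T - S ** U.
Proof. by apply: bop_ext => x; rewrite bopB !bop_compE bopB linearB. Qed.

Lemma bop_compZr a (S : bop H K) (U : bop G H) : S ** (a *: U) = a *: (S ** U).
Proof. by apply: bop_ext => x; rewrite bopZ !bop_compE bopZ linearZ. Qed.

Lemma bop_comp0l (U : bop G H) : (0 : bop H K) ** U = 0.
Proof. exact: bop_ext. Qed.

Lemma bop_comp0r (S : bop H K) : S ** (0 : bop G H) = 0.
Proof. by apply: bop_ext => x; rewrite bop_compE bop0 linear0. Qed.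

Lemma bop_comp_suml I (r : seq I) (P : pred I) (F : I -> bop H K) (U : bop G H) :
  (\sum_(i <- r | P i) F i) ** U = \sum_(i <- r | P i) F i ** U.
Proof. by apply: bop_ext => x; rewrite bop_sum bop_compE bop_sum. Qed.

Lemma bop_comp_sumr I (r : seq I) (P : pred I) (S : bop H K) (F : I -> bop G H) :
  S ** (\sum_(i <- r | P i) F i) = \sum_(i <- r | P i) S ** F i.
Proof. by apply: bop_ext => x; rewrite bop_sum bop_compE bop_sum linear_sum. Qed.

Lemma rnorm_comp (S : bop H K) (T : bop G H) :
  rnorm (S ** T) <= rnorm S * rnorm T.
Proof.
apply: rnorm_bop_bound => [|x]; first by rewrite mulr_ge0 ?rnorm_ge0.
rewrite bop_compE (le_trans (rnorm_bop_apply _ _))// -mulrA ler_wpM2l ?rnorm_ge0//.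
exact: rnorm_bop_apply.
Qed.

Lemma bop_comp1l (T : bop H K) : bop1 ** T = T.
Proof. exact: bop_ext. Qed.

Lemma bop_comp1r (T : bop H K) : T ** bop1 = T.
Proof. exact: bop_ext. Qed.

End BopComp.

Section BopComplete.
Variables (R : realType) (H : normedModType R[i]) (K : completeNormedModType R[i]).

Lemma bop_complete (u : nat -> bop H K) : rcauchy u -> exists T, rconv u T.
Proof.
move=> uc; have /choice[l ul] x : exists y, rconv (fun n => u n x) y.
  apply: rcauchy_rconv => e e0.
  have x1 : 0 < rnorm x + 1 by rewrite ltr_wpDl// rnorm_ge0.
  have [N Nu] := uc _ (divr_gt0 e0 x1); exists N => n /Nu.
  rewrite ltr_pdivlMr//; apply: le_lt_trans; rewrite -bopB.
  by rewrite (le_trans (rnorm_bop_apply _ _))// ler_wpM2l ?rnorm_ge0// lerDl.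
have l_lin : linear l.
  move=> a x y; apply: rconv_unique (ul _) _.
  have := rconvD (rconvZ a (ul x)) (ul y).
  by congr rconv; apply/funext => n; rewrite linearP.
have lu e : 0 < e -> exists N, forall n, (N <= n)%N ->
    forall x, rnorm (l x - u n x) <= e * rnorm x.
  move=> e0; have e2 : 0 < e / 2 by rewrite divr_gt0.
  have [N Nu] := uc _ e2; exists N => n Nn x.
  apply: (rconv_le (ul x) (N := N)) => m Nm.
  rewrite -bopB (le_trans (rnorm_bop_apply _ _))// ler_wpM2r ?rnorm_ge0//.
  rewrite -(subrK (u N) (u m)) -addrA (le_trans (rnormD _ _))// (splitr e).
  by rewrite lerD// ltW ?Nu// rnormB Nu.
have lb : bounded_linear l.
  split=> //; have [N Nl] := lu 1 ltr01.
  exists (rnorm (u N) + 1)%:C => x; rewrite -!rnormE -rmorphM lecR.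
  rewrite -(subrK (u N x) (l x)) (le_trans (rnormD _ _))// mulrDl addrC.
  by rewrite lerD ?rnorm_bop_apply// Nl.
exists (bop_of lb) => e e0; have e2 : 0 < e / 2 by rewrite divr_gt0.
have [N Nl] := lu _ e2; exists N => n Nn.
apply: (@le_lt_trans _ _ (e / 2)); last by rewrite ltr_pdivrMr// ltr_pMr ?ltr1n.
by apply: rnorm_bop_bound; [rewrite ltW|move=> x; exact: Nl].
Qed.

End BopComplete.

Section RconvComp.
Variables (R : realType) (G H K : normedModType R[i]).

Lemma rconv_compr (T : bop G H) (u : nat -> bop H K) l :
  rconv u l -> rconv (fun n => u n ** T) (l ** T).
Proof.
apply: (@rconv_map _ _ _ (fun S => S ** T) (rnorm T)) => x y.
by rewrite -bop_compBl mulrC rnorm_comp.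
Qed.

Lemma rconv_comp (u : nat -> bop H K) (v : nat -> bop G H) l m :
  rconv u l -> rconv v m -> rconv (fun n => u n ** v n) (l ** m).
Proof.
move=> ul vm; have [N Nu] := ul 1 ltr01.
have w0 : rconv (fun n => u n ** (v n - m)) 0.
  move=> e e0; have c0 : 0 < 1 + rnorm l by rewrite ltr_pwDl// rnorm_ge0.
  have [M Mv] := vm _ (divr_gt0 e0 c0).
  exists (maxn N M) => n; rewrite geq_max => /andP[Nn Mn].
  rewrite sub0r rnormN (le_lt_trans (rnorm_comp _ _))// rnormB.
  have := Mv n Mn; rewrite ltr_pdivlMr// mulrC; apply: le_lt_trans.
  rewrite ler_wpM2r ?rnorm_ge0//.
  rewrite -(subrK l (u n)) (le_trans (rnormD _ _))// lerD2r rnormB.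
  exact/ltW/Nu.
have := rconvD w0 (rconv_compr m ul); rewrite add0r.
by congr rconv; apply/funext => n; rewrite bop_compBr subrK.
Qed.

End RconvComp.

Section Adjoint.
Variables (R : realType).
Implicit Types G H K : hilbertType R.

Lemma adjoint_ex H K (T : bop H K) : exists S, is_adjoint T S.
Proof.
have [||S [TS _ _]] := @factor_adjoint _ _ _ _ bop1 T (rnorm T).
- exact: rnorm_ge0.
- exact: rnorm_bop_apply.
- by exists S.
Qed.

Definition adj H K (T : bop H K) : bop K H := projT1 (cid (adjoint_ex T)).

Lemma adjP H K (T : bop H K) x y : hdot (T x) y = hdot x (adj T y).
Proof. by rewrite /adj; case: cid => S /=; apply. Qed.

Lemma adj_unique H K (T : bop H K) S : is_adjoint T S -> S = adj T.
Proof.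
by move=> TS; apply: bop_ext => y; apply: hdot_inj => x; rewrite -TS adjP.
Qed.

Lemma adjPr H K (T : bop H K) x y : hdot (adj T x) y = hdot x (T y).
Proof. by rewrite hdotC -adjP -hdotC. Qed.

Lemma adjK H K : cancel (@adj H K) (@adj K H).
Proof. by move=> T; apply/esym/adj_unique => x y; exact: adjPr. Qed.

Lemma adj_comp G H K (S : bop H K) (T : bop G H) : adj (S ** T) = adj T ** adj S.
Proof. by apply/esym/adj_unique => x y; rewrite !bop_compE !adjP. Qed.

Lemma adjZD H K a (S T : bop H K) :
  adj (a *: S + T) = Num.conj a *: adj S + adj T.
Proof.
apply/esym/adj_unique => x y.
by rewrite !bopD !bopZ linearPl linearPr/= !adjP conjCK.
Qed.

Lemma adjZ H K a (T : bop H K) : adj (a *: T) = Num.conj a *: adj T.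
Proof.
apply/esym/adj_unique => x y.
by rewrite !bopZ linearZl_LR linearZr_LR/= !adjP conjCK.
Qed.

Lemma adjD H K (S T : bop H K) : adj (S + T) = adj S + adj T.
Proof. by rewrite -[S]scale1r adjZD rmorph1 !scale1r. Qed.

Lemma adjN H K (T : bop H K) : adj (- T) = - adj T.
Proof. by rewrite -scaleN1r adjZ rmorphN rmorph1 scaleN1r. Qed.

Lemma adjB H K (S T : bop H K) : adj (S - T) = adj S - adj T.
Proof. by rewrite adjD adjN. Qed.

Lemma adj0 H K : adj (0 : bop H K) = 0.
Proof. by rewrite -(scale0r 0) adjZ rmorph0 !scale0r. Qed.

Lemma adj1 H : adj (bop1 : bop H H) = bop1.
Proof. by apply/esym/adj_unique. Qed.

Lemma adj_sum H K I (r : seq I) (P : pred I) (F : I -> bop H K) :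
  adj (\sum_(i <- r | P i) F i) = \sum_(i <- r | P i) adj (F i).
Proof. by elim/big_rec2: _ => [|i S T _ <-]; rewrite ?adj0 ?adjD. Qed.

Lemma rnorm_adj H K (T : bop H K) : rnorm (adj T) = rnorm T.
Proof.
have le (G L : hilbertType R) (S : bop G L) : rnorm (adj S) <= rnorm S.
  apply: rnorm_bop_bound => [|x]; first exact: rnorm_ge0.
  have [->|Sx] := eqVneq (adj S x) 0; first by rewrite rnorm0 mulr_ge0 ?rnorm_ge0.
  have Sx0 : 0 < rnorm (adj S x) by rewrite lt_neqAle eq_sym rnorm_eq0 Sx rnorm_ge0.
  rewrite -(ler_pM2r Sx0) -expr2 -rdotE {1}/rdot -adjP -/(rdot _ _).
  rewrite (le_trans (rdot_le _ _))// mulrAC ler_wpM2r ?rnorm_ge0//.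
  exact: rnorm_bop_apply.
by apply/eqP; rewrite eq_le le -{1}[T]adjK le.
Qed.

Lemma rconv_adj H K (u : nat -> bop H K) T :
  rconv u T -> rconv (fun n => adj (u n)) (adj T).
Proof.
by apply: (@rconv_map _ _ _ _ 1) => S U; rewrite -adjB rnorm_adj mul1r.
Qed.

Lemma adj_setE H K (M : set (bop H K)) : adj_set M = @adj H K @` M.
Proof.
apply/seteqP; split=> [_ [T MT /adj_unique ->]|_ [T MT <-]]; first by exists T.
by exists T => // x y; exact: adjP.
Qed.

Lemma adj_setP H K (M : set (bop H K)) T : M T -> adj_set M (adj T).
Proof. by rewrite adj_setE; exists T. Qed.

End Adjoint.

(** * Closed linear spans and closed subspaces *)

Section ClosedSpan.
Variables (R : realType).
Implicit Types V W : normedModType R[i].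

Definition closed_subspace V (S : set V) := is_subspace S /\ closed S.

Lemma closed_subspace0 V (S : set V) : closed_subspace S -> S 0.
Proof. by case=> [[]]. Qed.

Lemma closed_subspaceZD V (S : set V) a x y :
  closed_subspace S -> S x -> S y -> S (a *: x + y).
Proof. by case=> [[_]] + _ => /(_ a x y). Qed.

Lemma closed_subspaceD V (S : set V) x y :
  closed_subspace S -> S x -> S y -> S (x + y).
Proof. by move=> cS Sx Sy; rewrite -[x]scale1r; exact: closed_subspaceZD. Qed.

Lemma closed_subspaceZ V (S : set V) a x :
  closed_subspace S -> S x -> S (a *: x).
Proof.
move=> cS Sx; rewrite -[_ *: _]addr0; apply: closed_subspaceZD => //.
exact: closed_subspace0.
Qed.

Lemma closed_subspaceB V (S : set V) x y :
  closed_subspace S -> S x -> S y -> S (x - y).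
Proof.
move=> cS Sx Sy; rewrite addrC -scaleN1r; exact: closed_subspaceZD.
Qed.

Lemma closed_subspace_sum V (S : set V) I (r : seq I) (P : pred I) (F : I -> V) :
  closed_subspace S -> (forall i, P i -> S (F i)) -> S (\sum_(i <- r | P i) F i).
Proof.
move=> cS SF; elim/big_ind: _ => //; first exact: closed_subspace0.
by move=> x y; exact: closed_subspaceD.
Qed.

Lemma closed_subspace_rconv V (S : set V) u x : closed_subspace S ->
  (forall n, S (u n)) -> rconv u x -> S x.
Proof. by case=> _ cS; exact: closed_rconv. Qed.

Lemma sub_closure_closed V (S W : set V) : S `<=` W -> closed_subspace W ->
  closure S `<=` W.
Proof. by move=> SW [_ /closure_id ->]; exact: closureS. Qed.

Lemma closure_is_subspace V (S : set V) : is_subspace S ->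
  closed_subspace (closure S).
Proof.
move=> [S0 SZD]; split; last exact: closed_closure.
split=> [|a x y]; first exact: subset_closure.
move=> /closure_rconv[u Su ux] /closure_rconv[v Sv vy].
apply/rnorm_closureP => e /(rconvD (rconvZ a ux) vy)[N Ne].
by exists (a *: u N + v N); [exact: SZD|exact: Ne].
Qed.

Lemma span_is_subspace V (S : set V) : is_subspace (smallest (@is_subspace R V) S).
Proof.
split=> [W [[]]//|a x y Sx Sy W SW].
by case: (SW) => -[_ WZD] _; apply: WZD; [exact: Sx|exact: Sy].
Qed.

Lemma closed_span_subspace V (S : set V) : closed_subspace (closed_span S).
Proof. exact/closure_is_subspace/span_is_subspace. Qed.

Lemma sub_closed_span V (S : set V) : S `<=` closed_span S.
Proof. by apply: subset_trans (@subset_closure _ _); exact: sub_gen_smallest. Qed.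

Lemma closed_span_min V (S W : set V) : closed_subspace W -> S `<=` W ->
  closed_span S `<=` W.
Proof.
move=> cW SW; apply: sub_closure_closed (cW) => x; apply; split=> //.
by case: cW.
Qed.

Lemma closed_span_mono V (S T : set V) : S `<=` T ->
  closed_span S `<=` closed_span T.
Proof.
move=> ST; apply: closed_span_min; first exact: closed_span_subspace.
exact: subset_trans ST (@sub_closed_span _ _).
Qed.

(** The map [s] on scalars covers linear maps and the conjugate-linear adjoint at once. Such
    preimages are the targets of [closed_span_min] and [Kinfty_min], which reduce a membership to
    generators. *)
Lemma closed_subspace_preimage V W (f : V -> W) (s : R[i] -> R[i]) (c : R)
    (S : set W) : closed_subspace S ->
  (forall a x y, f (a *: x + y) = s a *: f x + f y) -> f 0 = 0 ->
  (forall x y, rnorm (f x - f y) <= c * rnorm (x - y)) ->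
  closed_subspace (f @^-1` S).
Proof.
move=> cS fs f0 fc; split; first split.
- by rewrite /preimage/= f0; exact: closed_subspace0.
- by move=> a x y Sx Sy; rewrite /preimage/= fs; exact: closed_subspaceZD.
- move=> x /closure_rconv[u Su ux].
  exact: (@closed_subspace_rconv _ S (f \o u) _ cS Su (rconv_map fc ux)).
Qed.

Lemma closed_subspace_set0 V : closed_subspace [set (0 : V)].
Proof.
split; first by split=> // a x y -> ->; rewrite scaler0 addr0.
move=> x /closure_rconv[u u0 ux]; apply: (rconv_unique ux).
by rewrite (_ : u = fun=> 0); [exact: rconv_cst|exact/funext].
Qed.

End ClosedSpan.

Section BopPreimage.
Variables (R : realType).
Implicit Types G H K L : normedModType R[i].

Lemma closed_subspace_comp G H K L (A : bop K L) (B : bop G H) (W : set (bop G L)) :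
  closed_subspace W -> closed_subspace [set T : bop H K | W (A ** T ** B)].
Proof.
move=> cW; apply: (@closed_subspace_preimage _ _ _ (fun T => A ** T ** B) id
  (rnorm A * rnorm B) _ cW) => [a S T||S T].
- by rewrite bop_compDr bop_compZr bop_compDl bop_compZl.
- by rewrite bop_comp0r bop_comp0l.
- rewrite -bop_compBl -bop_compBr mulrAC (le_trans (rnorm_comp _ _))//.
  by rewrite ler_wpM2r ?rnorm_ge0// rnorm_comp.
Qed.

Lemma closed_subspace_compl H K L (A : bop K L) (W : set (bop H L)) :
  closed_subspace W -> closed_subspace [set T : bop H K | W (A ** T)].
Proof.
move=> /(@closed_subspace_comp _ _ _ _ A bop1).
by congr closed_subspace; apply/funext => T; rewrite /mkset/= bop_comp1r.
Qed.

Lemma closed_subspace_compr G H K (B : bop G H) (W : set (bop G K)) :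
  closed_subspace W -> closed_subspace [set T : bop H K | W (T ** B)].
Proof.
move=> /(@closed_subspace_comp _ _ _ _ bop1 B).
by congr closed_subspace; apply/funext => T; rewrite /mkset/= bop_comp1l.
Qed.

Lemma closed_subspace_fix H K (A : bop K K) :
  closed_subspace [set T : bop H K | A ** T = T].
Proof.
have := @closed_subspace_compl _ _ _ (A - bop1) _ (closed_subspace_set0 (bop H K)).
congr closed_subspace; apply/funext => T; apply/propext; rewrite /mkset/=.
rewrite bop_compBl bop_comp1l; split=> [/eqP|->]; last exact: subrr.
by rewrite subr_eq0 => /eqP.
Qed.

Lemma closed_subspace_fixr H K (A : bop H H) :
  closed_subspace [set T : bop H K | T ** A = T].
Proof.
have := @closed_subspace_compr _ _ _ (A - bop1) _ (closed_subspace_set0 (bop H K)).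
congr closed_subspace; apply/funext => T; apply/propext; rewrite /mkset/=.
rewrite bop_compBr bop_comp1r; split=> [/eqP|->]; last exact: subrr.
by rewrite subr_eq0 => /eqP.
Qed.

End BopPreimage.

Section AdjPreimage.
Variables (R : realType).
Implicit Types H K : hilbertType R.

Lemma closed_subspace_adj H K (W : set (bop K H)) :
  closed_subspace W -> closed_subspace [set T : bop H K | W (adj T)].
Proof.
move=> cW; apply: (@closed_subspace_preimage _ _ _ (@adj R H K) Num.conj 1 _ cW).
- exact: adjZD.
- exact: adj0.
- by move=> S T; rewrite -adjB rnorm_adj mul1r.
Qed.

End AdjPreimage.

(** * Square roots and polar decomposition *)

Section RealScalars.
Variables (R : realType).

Lemma rnormZr (V : normedModType R[i]) (t : R) (x : V) : 0 <= t ->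
  rnorm (t%:C *: x) = t * rnorm x.
Proof. by move=> t0; rewrite rnormZ ger0_norm ?ler0c. Qed.

Lemma conjC_real (t : R) : Num.conj (t%:C : R[i]) = t%:C.
Proof. by rewrite conj_Creal// complex_real. Qed.

End RealScalars.

Section SquareRoot.
Variables (R : realType) (H : hilbertType R).
Implicit Types X Y : bop H H.

(** A fixed point Y of Y |-> (X + Y^2)/2 satisfies (1 - Y)^2 = 1 - X. All iterates are polynomials
    in X, so subspaces preserved by X are preserved by the limit when they are closed. *)
Fixpoint sqrt_iter X n : bop H H :=
  if n is m.+1 then (2^-1)%:C *: (X + sqrt_iter X m ** sqrt_iter X m) else 0.

Fixpoint sqrt_bound n : R :=
  if n is m.+1 then 2^-1 * (1 + sqrt_bound m * sqrt_bound m) else 0.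

Lemma sqrt_bound01 n : 0 <= sqrt_bound n <= 1.
Proof.
by elim: n => [|n /andP[n0 n1]] /=; rewrite ?lexx ?ler01//; nra.
Qed.

Lemma sqrt_iter_le X n : rnorm X <= 1 -> rnorm (sqrt_iter X n) <= sqrt_bound n.
Proof.
move=> X1; elim: n => [|n IHn] /=; first by rewrite rnorm0.
rewrite rnormZr ?invr_ge0// ler_wpM2l ?invr_ge0//.
rewrite (le_trans (rnormD _ _))// lerD// (le_trans (rnorm_comp _ _))//.
by rewrite ler_pM ?rnorm_ge0.
Qed.

(** Y^2 - Z^2 = Y (Y - Z) + (Y - Z) Z has norm at most (a + b)(a - b) = a^2 - b^2. *)
Lemma half_square_le X Y Z (a b : R) :
  rnorm Y <= a -> rnorm Z <= b -> rnorm (Y - Z) <= a - b ->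
  rnorm ((2^-1)%:C *: (X + Y ** Y) - (2^-1)%:C *: (X + Z ** Z)) <=
  2^-1 * (1 + a * a) - 2^-1 * (1 + b * b).
Proof.
move=> Ya Zb YZ; rewrite -scalerBr -mulrBr rnormZr ?invr_ge0//.
rewrite ler_wpM2l ?invr_ge0// opprD addrACA subrr add0r.
rewrite (_ : Y ** Y - Z ** Z = Y ** (Y - Z) + (Y - Z) ** Z); last first.
  by rewrite bop_compBr bop_compBl addrA subrK.
rewrite (le_trans (rnormD _ _))//.
have : rnorm (Y ** (Y - Z)) <= a * (a - b).
  by rewrite (le_trans (rnorm_comp _ _))// ler_pM ?rnorm_ge0.
have : rnorm ((Y - Z) ** Z) <= (a - b) * b.
  by rewrite (le_trans (rnorm_comp _ _))// ler_pM ?rnorm_ge0.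
lra.
Qed.

Lemma sqrt_iterS_le X n : rnorm X <= 1 ->
  rnorm (sqrt_iter X n.+1 - sqrt_iter X n) <= sqrt_bound n.+1 - sqrt_bound n.
Proof.
move=> X1; elim: n => [|n IHn].
  rewrite [sqrt_iter X 0]/= [sqrt_bound 0]/= 2!subr0. exact: sqrt_iter_le 1 X1.
exact: half_square_le (sqrt_iter_le n.+1 X1) (sqrt_iter_le n X1) IHn.
Qed.

(* The increments of the iteration are dominated by those of its scalar
   analogue [sqrt_bound], which is increasing and bounded by [1]. *)
Lemma sqrt_iter_cvg X : rnorm X <= 1 -> exists2 Y, rconv (sqrt_iter X) Y &
  (bop1 - Y) ** (bop1 - Y) = bop1 - X.
Proof.
move=> X1; have [|Y XY] := @bop_complete _ _ _ (sqrt_iter X).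
  apply: (rcauchy_telescope (c := 1)) (fun n => sqrt_iterS_le n X1) _ => n.
  by case/andP: (sqrt_bound01 n).
exists Y => //.
have : Y = (2^-1)%:C *: (X + Y ** Y).
  have Y1 : rconv (fun n => sqrt_iter X n.+1) Y.
    by move=> e /XY[N Ne]; exists N => n Nn; apply: Ne; exact: leqW.
  apply: rconv_unique Y1 _.
  exact: rconvZ (rconvD (@rconv_cst _ _ X) (rconv_comp XY XY)).
move=> /(congr1 (fun Z => 2%:C *: Z)).
rewrite scalerA -rmorphM/= divff// scale1r => Y2.
rewrite bop_compBr bop_comp1r bop_compBl bop_comp1l opprB.
have -> : Y ** Y = Y + Y - X.
  have -> : Y + Y = 2%:C *: Y.
    by rewrite -[in LHS](scale1r Y) -scalerDl -[1 in LHS]/(1%:C) -rmorphD.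
  by rewrite Y2 addrAC subrr add0r.
by rewrite (addrAC (Y + Y)) addrK addrA subrK.
Qed.

End SquareRoot.

Section Polar.
Variables (R : realType).
Implicit Types H K : hilbertType R.

Lemma closure_range_subspace H K (P : bop H K) : closed_subspace (closure (range P)).
Proof.
apply: closure_is_subspace; split; first by exists 0; rewrite ?linear0.
by move=> a _ _ [x _ <-] [y _ <-]; exists (a *: x + y); rewrite ?linearP.
Qed.

(** The square expands to |x|^2 - 2 |T x|^2 + |T^* T x|^2, and |T^* T x| <= |T x|. It shows that 1 -
    T^* T is a contraction, with a gain of |T x|^2 that can be summed along its powers. *)
Lemma sub_adj_contraction H K (T : bop H K) x : rnorm T <= 1 ->
  rnorm (x - adj T (T x)) ^+ 2 <= rnorm x ^+ 2 - rnorm (T x) ^+ 2.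
Proof.
move=> T1; rewrite sqr_rnormB rdotC {1}/rdot adjPr -/(rdot _ _) rdotE.
have : rnorm (adj T (T x)) ^+ 2 <= rnorm (T x) ^+ 2.
  rewrite ler_pXn2r ?nnegrE ?rnorm_ge0//.
  rewrite (le_trans (rnorm_bop_apply _ _))// rnorm_adj ler_piMl ?rnorm_ge0//.
lra.
Qed.

(** [P] is a norm limit of polynomials in [adj T ** T], hence the last clause: it preserves each
    closed subspace that [adj T ** T] preserves. [U] is the adjoint of the factor given by
    [factor_adjoint], applicable since |T x| = |P x|. *)
Lemma polar_decomposition H K (T : bop H K) : rnorm T <= 1 ->
  exists (P : bop H H) (U : bop H K),
    [/\ rnorm U <= 1, U ** P = T, adj U ** T = P, P ** P = adj T ** T &
        forall (L : normedModType R[i]) (C : set (bop L H)), closed_subspace C ->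
          (forall c, C c -> C (adj T ** T ** c)) ->
          forall c, C c -> C (P ** c)].
Proof.
move=> T1; pose X := bop1 - adj T ** T.
have X1 : rnorm X <= 1.
  apply: rnorm_bop_bound => // x; rewrite mul1r.
  rewrite -(@ler_pXn2r _ 2)// ?nnegrE ?rnorm_ge0//.
  have := sub_adj_contraction x T1; have := sqr_ge0 (rnorm (T x)).
  by rewrite bopB /=; lra.
have [Y XY YE] := sqrt_iter_cvg X1; pose P := bop1 - Y.
have PP : P ** P = adj T ** T by rewrite YE /X opprB addrC subrK.
have Xadj : adj X = X by rewrite adjB adj1 adj_comp adjK.
have Padj : adj P = P.
  rewrite adjB adj1; congr (_ - _).
  apply: rconv_unique (rconv_adj XY) _.
  rewrite [X in rconv X](_ : _ = sqrt_iter X)//; apply/funext.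
  elim=> [|n IHn] /=; first by rewrite adj0.
  by rewrite adjZ conjC_real adjD adj_comp Xadj IHn.
have Pdot x y : hdot (P x) (P y) = hdot (T x) (T y).
  by rewrite adjP Padj -bop_compE PP bop_compE -adjP.
have [x|V [TV VP V1]] := @factor_adjoint _ _ _ _ P T 1 ler01.
  by rewrite mul1r -(@ler_pXn2r _ 2)// ?nnegrE ?rnorm_ge0// -!rdotE /rdot Pdot.
have adjT : adj T = P ** V.
  by apply/esym/adj_unique => x w; rewrite TV adjP Padj.
exists P, (adj V); split => //.
- by rewrite rnorm_adj; apply: rnorm_bop_bound => // x.
- by rewrite -[RHS]adjK adjT adj_comp Padj.
(* V (T x) - P x lies in the closure of the range of [P] and is orthogonal to that range. *)
- rewrite adjK; apply: bop_ext => x; apply/eqP; rewrite -subr_eq0; apply/eqP.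
  apply: (@closure_range_ortho _ _ _ P) => [|y].
    apply: (closed_subspaceB (closure_range_subspace P)); first exact: VP.
    by apply: subset_closure; exists x.
  by rewrite linearBr/= -TV Pdot subrr.
- move=> L C cC TC c Cc; rewrite bop_compBl bop_comp1l.
  apply: (closed_subspaceB cC) => //.
  apply: (closed_subspace_rconv cC _ (rconv_compr c XY)) => n.
  elim: n c Cc => [|n IHn] c Cc /=.
    by rewrite bop_comp0l; exact: closed_subspace0.
  rewrite bop_compZl; apply: (closed_subspaceZ _ cC); rewrite bop_compDl.
  apply: (closed_subspaceD cC); last by rewrite -bop_compA; apply/IHn/IHn.
  by rewrite bop_compBl bop_comp1l; apply: (closed_subspaceB cC); last exact: TC.
Qed.

(** Elements of [C] are approximated by T^* n and then by T^* T c = P (P c), so the products P c are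
    dense in [C]. On them U (P c) = T c and U^* U (P c) = U^* T c = P c. Dually, U^* (T c) = P c and
    U U^* (T c) = U (P c) = T c on the dense products T c of [N]. Everything passes to the
    closure. *)
Lemma polar_equivalence H K (L : normedModType R[i]) (T : bop H K)
    (C : set (bop L H)) (N : set (bop L K)) :
  rnorm T <= 1 -> closed_subspace C -> closed_subspace N ->
  (forall c, C c -> N (T ** c)) -> (forall n, N n -> C (adj T ** n)) ->
  N `<=` closure [set T ** c | c in C] ->
  C `<=` closure [set adj T ** n | n in N] ->
  exists U : bop H K,
    [/\ rnorm U <= 1,
        forall c, C c -> N (U ** c) /\ adj U ** U ** c = c &
        forall n, N n -> C (adj U ** n) /\ U ** adj U ** n = n].
Proof.
move=> T1 cC cN TC TN NT CT.
have [P [U [U1 UP UT PP PC]]] := polar_decomposition T1.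
have {PC} PC c : C c -> C (P ** c).
  by apply: PC => // d Cd; rewrite -bop_compA; exact/TN/TC.
have comp_sub (G : hilbertType R) (S : bop H G) :
    is_subspace [set S ** c | c in C].
  split; first by exists 0; rewrite ?bop_comp0r//; exact: closed_subspace0.
  move=> a _ _ [x Cx <-] [y Cy <-].
  by exists (a *: x + y); [exact: closed_subspaceZD|rewrite bop_compDr bop_compZr].
have CP : C `<=` closure [set P ** c | c in C].
  have cP := closure_is_subspace (comp_sub _ P).
  apply: subset_trans CT _; apply: sub_closure_closed (cP) => _ [n Nn <-].
  apply: (sub_closure_closed _ (closed_subspace_compl (adj T) cP) (NT n Nn)).
  move=> _ [c Cc <-]; apply: subset_closure; exists (P ** c); first exact: PC.
  by rewrite !bop_compA PP.
exists U; split=> // [c Cc|n Nn].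
- split.
    apply: (sub_closure_closed _ (closed_subspace_compl U cN) (CP c Cc)).
    by move=> _ [d Cd <-]; rewrite /mkset bop_compA UP; exact: TC.
  apply: (sub_closure_closed _ (closed_subspace_fix _ (adj U ** U)) (CP c Cc)).
  by move=> _ [d Cd <-]; rewrite /mkset -bop_compA (bop_compA U) UP bop_compA UT.
- split.
    apply: (sub_closure_closed _ (closed_subspace_compl (adj U) cC) (NT n Nn)).
    by move=> _ [d Cd <-]; rewrite /mkset bop_compA UT; exact: PC.
  apply: (sub_closure_closed _ (closed_subspace_fix _ (U ** adj U)) (NT n Nn)).
  by move=> _ [d Cd <-]; rewrite /mkset -bop_compA (bop_compA (adj U)) UT bop_compA UP.
Qed.

End Polar.

(** * Infinite matrices of operators *)

Section Coordinates.
Variables (R : realType) (H : hilbertType R).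
Implicit Types (x : H) (xi : ell2 H).

Definition delta_seq i x : nat -> H := fun k => if k == i then x else 0.

Lemma sum_delta_seq (V : nmodType) (f : nat -> H -> V) i x n :
  (forall k, f k 0 = 0) ->
  \sum_(0 <= k < n) f k (delta_seq i x k) = if (i < n)%N then f i x else 0.
Proof.
move=> f0; transitivity (\sum_(0 <= k < n | k == i) f k x); last exact: big_nat1_eq.
rewrite [RHS]big_mkcond/=.
by apply: eq_bigr => k _; rewrite /delta_seq; case: ifP => // /eqP ->.
Qed.

Lemma square_summable_delta i x : square_summable (delta_seq i x).
Proof.
apply: (@square_summable_le _ _ _ (rnorm x ^+ 2)) => n.
rewrite /series/= (sum_delta_seq (f := fun=> fun y => rnorm y ^+ 2)).
  by case: ifP => // _; exact: sqr_ge0.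
by move=> _; rewrite rnorm0 expr0n.
Qed.

Definition delta_ell2 i x : ell2 H :=
  Ell2 (introT (asboolP (square_summable _)) (@square_summable_delta i x)).

Lemma delta_ell2E i x k : delta_ell2 i x k = if k == i then x else 0.
Proof. by []. Qed.

Lemma ell2D (xi eta : ell2 H) k : (xi + eta) k = xi k + eta k. Proof. by []. Qed.

Lemma ell2Z a xi k : (a *: xi) k = a *: xi k. Proof. by []. Qed.

Lemma ell2_sum I (r : seq I) (P : pred I) (F : I -> ell2 H) k :
  (\sum_(i <- r | P i) F i) k = \sum_(i <- r | P i) F i k.
Proof. by elim/big_rec2: _ => // i y S _ <-. Qed.

Lemma hdot_delta i x xi : hdot (delta_ell2 i x) xi = hdot x (xi i).
Proof.
apply: ell2_dotP; split; apply: cvg_near_cst; exists i.+1 => // n /= ni.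
  rewrite /series/= (sum_delta_seq (f := fun k y => complex.Re (hdot y (xi k)))).
    by rewrite ni.
  by move=> k; rewrite linear0l.
rewrite /series/= (sum_delta_seq (f := fun k y => complex.Im (hdot y (xi k)))).
  by rewrite ni.
by move=> k; rewrite linear0l.
Qed.

Lemma rnorm_delta i x : rnorm (delta_ell2 i x) = rnorm x.
Proof.
apply/eqP; rewrite -(@eqrXn2 _ 2)// ?rnorm_ge0// -!rdotE /rdot hdot_delta.
by rewrite delta_ell2E eqxx.
Qed.

Lemma bounded_linear_delta i : bounded_linear (delta_ell2 i).
Proof.
split=> [a x y|].
  by apply: ell2_ext => k; rewrite ell2D ell2Z !delta_ell2E; case: ifP; rewrite ?scaler0 ?addr0.
by exists 1 => x; rewrite -!rnormE rnorm_delta mul1r.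
Qed.

Definition inj i : bop H (ell2 H) := bop_of (bounded_linear_delta i).

Lemma injE i x k : inj i x k = if k == i then x else 0. Proof. by []. Qed.

Lemma bounded_linear_coord i : bounded_linear (fun xi : ell2 H => xi i).
Proof.
split=> [a x y|] //.
by exists 1 => x; rewrite -!rnormE mul1r lecR ell2_coord_le.
Qed.

Definition proj i : bop (ell2 H) H := bop_of (bounded_linear_coord i).

Lemma projE i xi : proj i xi = xi i. Proof. by []. Qed.

Lemma adj_inj i : adj (inj i) = proj i.
Proof. by apply/esym/adj_unique => x xi; exact: hdot_delta. Qed.

Lemma adj_proj i : adj (proj i) = inj i.
Proof. by rewrite -adj_inj adjK. Qed.

Lemma proj_inj i j : proj i ** inj j = if i == j then bop1 else 0.
Proof. by apply: bop_ext => x; rewrite bop_compE projE injE; case: ifP. Qed.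

Lemma rnorm_inj i : rnorm (inj i) <= 1.
Proof. by apply: rnorm_bop_bound => // x; rewrite mul1r [in leLHS]/= rnorm_delta. Qed.

Lemma rnorm_proj i : rnorm (proj i) <= 1.
Proof. by rewrite -adj_inj rnorm_adj rnorm_inj. Qed.

Definition trunc n : bop (ell2 H) (ell2 H) := \sum_(i < n) inj i ** proj i.

Lemma truncE n xi : trunc n xi = \sum_(i < n) inj i (xi i).
Proof. by rewrite bop_sum. Qed.

Lemma trunc_coord n xi k : trunc n xi k = if (k < n)%N then xi k else 0.
Proof.
rewrite truncE ell2_sum -(big_mkord xpredT (fun i => inj i (xi i) k)).
under eq_bigr do rewrite injE eq_sym.
by rewrite -big_mkcond/= big_nat1_eq.
Qed.

Lemma trunc_inj n i : (i < n)%N -> trunc n ** inj i = inj i.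
Proof.
move=> ni; apply: bop_ext => x; apply: ell2_ext => k.
by rewrite bop_compE trunc_coord injE; case: ifP => // kn; case: eqP kn => // ->; rewrite ni.
Qed.

Lemma proj_trunc n i : (i < n)%N -> proj i ** trunc n = proj i.
Proof.
by move=> ni; apply: bop_ext => x; rewrite bop_compE !projE trunc_coord ni.
Qed.

End Coordinates.

Section Place.
Variables (R : realType).
Implicit Types H K L : hilbertType R.

Definition place H K i j (T : bop H K) : bop (ell2 H) (ell2 K) :=
  inj K i ** T ** proj H j.

Lemma placeZ H K i j a (T : bop H K) : place i j (a *: T) = a *: place i j T.
Proof. by rewrite /place bop_compZr bop_compZl. Qed.

Lemma place_comp H K L i j k l (S : bop K L) (T : bop H K) :
  place i j S ** place k l T = if j == k then place i l (S ** T) else 0.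
Proof.
rewrite /place !bop_compA -(bop_compA (inj L i ** S)) proj_inj.
case: ifP => _; first by rewrite bop_comp1r.
by rewrite bop_comp0r !bop_comp0l.
Qed.

Lemma adj_place H K i j (T : bop H K) : adj (place i j T) = place j i (adj T).
Proof. by rewrite /place !adj_comp adj_inj adj_proj bop_compA. Qed.

Lemma rnorm_place H K i j (T : bop H K) : rnorm (place i j T) <= rnorm T.
Proof.
rewrite (le_trans (rnorm_comp _ _))// -[leRHS]mulr1 ler_pM ?rnorm_ge0 ?rnorm_proj//.
rewrite (le_trans (rnorm_comp _ _))// -[leRHS]mul1r ler_wpM2r ?rnorm_ge0//.
exact: rnorm_inj.
Qed.

Lemma closed_subspace_place H K i j (W : set (bop (ell2 H) (ell2 K))) :
  closed_subspace W -> closed_subspace [set T : bop H K | W (place i j T)].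
Proof. exact: closed_subspace_comp. Qed.

Lemma finitely_supported_sum H K (X : set (bop H K)) T :
  finitely_supported X T -> exists n (A : 'M[bop H K]_n),
    (forall i j, X (A i j)) /\ T = \sum_(i < n) \sum_(j < n) place i j (A i j).
Proof.
move=> [n [A [XA TA T0]]]; exists n, A; split=> //.
apply: bop_ext => xi; apply: ell2_ext => k; rewrite bop_sum ell2_sum.
under eq_bigr do rewrite bop_sum ell2_sum.
have [kn|nk] := ltnP k n; last first.
  rewrite T0// big1// => i _; rewrite big1// => j _.
  by rewrite /place !bop_compE injE gtn_eqF// (leq_trans _ nk).
rewrite (TA xi (Ordinal kn)) [RHS](bigD1 (Ordinal kn))//= [X in _ + X]big1 ?addr0.
  by apply: eq_bigr => j _; rewrite /delta_seq eqxx.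
move=> i ik; rewrite big1// => j _; rewrite /delta_seq.
by rewrite ifN//; apply: contra ik => /eqP ik; apply/eqP/val_inj.
Qed.

(** Finite support becomes invariance under all large truncations, so that matrices of different
    sizes can be added without resizing; the entries are read off as corners. *)
Lemma finitely_supportedP H K (X : set (bop H K)) T : closed_subspace X ->
  finitely_supported X T <-> (forall i j, X (proj K i ** T ** inj H j)) /\
    exists n, forall N, (n <= N)%N -> trunc K N ** T ** trunc H N = T.
Proof.
move=> cX; split=> [|[XT [n /(_ n (leqnn n)) nT]]].
  move=> /finitely_supported_sum[n [A [XA ->]]]; split=> [k l|].
    rewrite !(bop_comp_suml, bop_comp_sumr); apply: closed_subspace_sum => // i _.
    rewrite !(bop_comp_suml, bop_comp_sumr); apply: closed_subspace_sum => // j _.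
    rewrite /place !bop_compA proj_inj -(bop_compA _ _ (inj H l)) proj_inj.
    case: ifP; case: ifP; rewrite ?bop_comp0r ?bop_comp0l ?bop_comp1r ?bop_comp1l// => _ _;
      exact: closed_subspace0.
  exists n => N nN.
  rewrite [X in X ** _]bop_comp_sumr bop_comp_suml; apply: eq_bigr => i _.
  rewrite [X in X ** _]bop_comp_sumr bop_comp_suml; apply: eq_bigr => j _.
  rewrite /place !bop_compA trunc_inj ?(leq_trans (ltn_ord _))//.
  by rewrite -!bop_compA proj_trunc ?(leq_trans (ltn_ord _)).
exists n, (\matrix_(i, j) (proj K i ** T ** inj H j)); split=> [i j|xi i|xi k nk].
- by rewrite mxE.
- rewrite -[in LHS]nT !bop_compE trunc_coord ltn_ord truncE linear_sum ell2_sum.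
  by apply: eq_bigr => j _; rewrite mxE.
- by rewrite -nT !bop_compE trunc_coord ltnNge nk.
Qed.

Lemma Kinfty_min H K (X : set (bop H K)) W : closed_subspace W ->
  (forall i j T, X T -> W (place i j T)) -> Kinfty X `<=` W.
Proof.
move=> cW XW; apply: sub_closure_closed (cW).
move=> _ /finitely_supported_sum[n [A [XA ->]]].
by apply: closed_subspace_sum => // i _; apply: closed_subspace_sum => // j _; exact: XW.
Qed.

Lemma Kinfty_subspace H K (X : set (bop H K)) : closed_subspace X ->
  closed_subspace (Kinfty X).
Proof.
move=> cX; apply: closure_is_subspace; split=> [|a S T].
  apply/finitely_supportedP => //; split=> [i j|].
    by rewrite bop_comp0r bop_comp0l; exact: closed_subspace0.
  by exists 0%N => N _; rewrite bop_comp0r bop_comp0l.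
move=> /finitely_supportedP-/(_ cX)[XS [n nS]].
move=> /finitely_supportedP-/(_ cX)[XT [m mT]].
apply/finitely_supportedP => //; split=> [i j|].
  rewrite bop_compDr bop_compZr bop_compDl bop_compZl.
  exact: closed_subspaceZD.
exists (maxn n m) => N; rewrite geq_max => /andP[nN mN].
by rewrite bop_compDr bop_compZr bop_compDl bop_compZl nS ?mT.
Qed.

Lemma Kinfty_place H K (X : set (bop H K)) i j T : closed_subspace X ->
  X T -> Kinfty X (place i j T).
Proof.
move=> cX XT; apply: subset_closure; apply/finitely_supportedP => //; split=> [k l|].
  rewrite /place !bop_compA proj_inj -(bop_compA _ _ (inj H l)) proj_inj.
  case: ifP; case: ifP; rewrite ?bop_comp0r ?bop_comp0l ?bop_comp1r ?bop_comp1l// => _ _;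
    exact: closed_subspace0.
exists (maxn i j).+1 => N; rewrite gtn_max => /andP[iN jN].
by rewrite /place !bop_compA trunc_inj// -!bop_compA proj_trunc.
Qed.

Lemma Kinfty_comp H K L (X : set (bop K L)) (Y : set (bop H K)) (Z : set (bop H L)) :
  closed_subspace Z -> (forall S T, X S -> Y T -> Z (S ** T)) ->
  forall S T, Kinfty X S -> Kinfty Y T -> Kinfty Z (S ** T).
Proof.
move=> cZ XYZ S T KS KT; have cK := Kinfty_subspace cZ.
apply: (Kinfty_min (closed_subspace_compr T cK) _ KS) => i j U XU.
apply: (Kinfty_min (closed_subspace_compl _ cK) _ KT) => k l V YV.
rewrite /mkset place_comp; case: ifP => _; last exact: closed_subspace0.
by apply: Kinfty_place => //; exact: XYZ.
Qed.

Lemma Kinfty_adj H K (X : set (bop H K)) (Y : set (bop K H)) : closed_subspace Y ->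
  (forall T, X T -> Y (adj T)) -> forall T, Kinfty X T -> Kinfty Y (adj T).
Proof.
move=> cY XY T KT; have cK := Kinfty_subspace cY.
apply: (Kinfty_min (closed_subspace_adj cK) _ KT) => i j U XU.
by rewrite /mkset adj_place; apply: Kinfty_place => //; exact: XY.
Qed.

End Place.

(** * Generating sequences of a TRO *)

Section GeneratingSequence.
Variables (R : realType).

Lemma countableU T (A B : set T) : countable A -> countable B -> countable (A `|` B).
Proof.
move=> cA cB; rewrite (_ : A `|` B = \bigcup_(b in [set: bool]) if b then A else B).
  by apply: bigcup_countable => //; case.
apply/seteqP; split=> [x [Ax|Bx]|x [[] _]]; [by exists true|by exists false|by left|by right].
Qed.

(** The elements spanned by countable subsets of [S] form a subspace containing [S], and the limit
    of a sequence of them needs only a countable union. *)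
Lemma closed_span_countable (V : normedModType R[i]) (S : set V) z :
  closed_span S z -> exists F, [/\ countable F, F `<=` S & closed_span F z].
Proof.
move=> Sz; pose Q := [set y : V | exists F, [/\ countable F, F `<=` S &
  closed_span F y]].
have QS : smallest (@is_subspace R V) S `<=` Q.
  apply: smallest_sub; last first.
    move=> x Sx; exists [set x]; split; first exact: countable1.
      by move=> _ ->.
    exact: sub_closed_span.
  split=> [|a x y [F [cF FS Fx]] [G [cG GS Gy]]].
    exists set0; split; [exact: countable0|by []|].
    exact: (closed_subspace0 (closed_span_subspace _)).
  exists (F `|` G); split; first exact: countableU.
    by move=> w [/FS|/GS].
  apply: (closed_subspaceZD _ (closed_span_subspace _)).
    by apply: closed_span_mono Fx => w; left.
  by apply: closed_span_mono Gy => w; right.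
have [u Su uz] := closure_rconv Sz.
have /choice[F FP] n : exists F, [/\ countable F, F `<=` S & closed_span F (u n)].
  exact: QS.
exists (\bigcup_(n in setT) F n); split.
- by apply: bigcup_countable => // n _; have [] := FP n.
- by move=> x [n _ Fx]; have [_ + _] := FP n; apply.
- apply: (closed_subspace_rconv (closed_span_subspace _) _ uz) => n.
  have [_ _] := FP n; apply: closed_span_mono => x Fx.
  by exists n.
Qed.

(** This turns a countable approximate identity of a coefficient algebra into countably many
    elements of the TRO. *)
Lemma countable_left_factors (H K L : hilbertType R) (M : set (bop K L))
    (N : set (bop H K)) (e : nat -> bop H L) :
  (forall n, closed_span (mul_set M N) (e n)) ->
  exists F, [/\ countable F, F `<=` M & forall n, closed_span (mul_set F N) (e n)].
Proof.
move=> eMN.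
have /choice[F FP] n : exists F, [/\ countable F, F `<=` M &
    closed_span (mul_set F N) (e n)].
  have [F [cF FMN Fe]] := closed_span_countable (eMN n).
  have /choice[g gP] z : exists S, F z -> M S /\ exists2 T, N T & S ** T = z.
    have [Fz|nFz] := pselect (F z); last by exists 0.
    by have [S MS [T NT <-]] := FMN _ Fz; exists S; split => //; exists T.
  exists (g @` F); split.
  - exact: sub_countable (card_image_le _ _) cF.
  - by move=> _ [z Fz <-]; have [] := gP z Fz.
  - apply: closed_span_mono Fe => z Fz; have [_ [T NT Tz]] := gP z Fz.
    by exists (g z); [exists z|exists T].
exists (\bigcup_(n in setT) F n); split.
- by apply: bigcup_countable => // n _; have [] := FP n.
- by move=> x [n _ Fx]; have [_ + _] := FP n; apply.
- move=> n; have [_ _] := FP n; apply: closed_span_mono => _ [S FS [T NT <-]].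
  by exists S; [exists n|exists T].
Qed.

(** Padding with 0 handles finite and empty [F] by a total sequence; 0 belongs to every subspace, so
    the padding is harmless. *)
Lemma countable_enumeration (V : normedModType R[i]) (F : set V) : countable F ->
  exists u : nat -> V, (forall n, F (u n) \/ u n = 0) /\ F `<=` range u.
Proof.
move=> /countable_injP[f finj].
have /choice[u uP] n : exists x, (F x \/ x = 0) /\ forall y, F y -> f y = n -> y = x.
  have [[x Fx fx]|nF] := pselect (exists2 x, F x & f x = n).
    by exists x; split=> [|y Fy fy]; [left|apply: finj; rewrite ?inE// fx fy].
  by exists 0; split=> [|y Fy fy]; [right|case: nF; exists y].
exists u; split=> [n|x Fx]; first by have [] := uP n.
by exists (f x) => //; have [_ /(_ x Fx erefl) <-] := uP (f x).
Qed.

Variables (H K : hilbertType R) (M : set (bop H K)).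
Hypothesis troM : TRO M.

Let cM : closed_subspace M := troM.1.

Lemma tro_mul S T U : M S -> M T -> M U -> M (S ** adj T ** U).
Proof.
move=> MS MT MU; apply: troM.2; exists (S ** adj T); last by exists U.
by exists S => //; exists (adj T) => //; exact: adj_setP.
Qed.

(* For a contraction [m] in [M], the operators [m (1 - m^* m)^n] lie in [M], and
   they tend to [0] in norm by the estimate [small] below, which replaces the
   functional calculus of [m^* m]. *)
Lemma tro_sub_triple : M `<=` closed_span [set S ** adj S ** T | S in M & T in M].
Proof.
set W := closed_span _; have cW : closed_subspace W := closed_span_subspace _.
suff cs m : M m -> rnorm m <= 1 -> W m.
  move=> m Mm; have m0 : 0 < 1 + rnorm m by rewrite ltr_pwDl// rnorm_ge0.
  have -> : m = (1 + rnorm m)%:C *: ((1 + rnorm m)^-1%:C *: m).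
    by rewrite scalerA -rmorphM/= divff ?gt_eqF// scale1r.
  apply: (closed_subspaceZ _ cW); apply: cs; first exact: closed_subspaceZ.
  rewrite rnormZr ?invr_ge0 ?(ltW m0)// ler_pdivrMl// mulr1.
  by rewrite lerDr.
move=> Mm m1; pose X := bop1 - adj m ** m.
pose x n := iter n (bop_comp X) bop1.
have mxS n : m ** x n.+1 = m ** x n - m ** adj m ** (m ** x n).
  by rewrite /= bop_compBl bop_comp1l bop_compBr !bop_compA.
have Mx n : M (m ** x n).
  elim: n => [|n IHn]; first by rewrite bop_comp1r.
  by rewrite mxS; apply: (closed_subspaceB cM) => //; exact: tro_mul.
(* Consecutive terms differ by m m^* (m X^n), which is one of the generating triples. *)
have Wx n : W (m - m ** x n).
  elim: n => [|n IHn].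
    by rewrite bop_comp1r subrr; exact: closed_subspace0.
  rewrite mxS opprB addrA; rewrite addrAC; apply: (closed_subspaceD cW) => //.
  by apply: sub_closed_span; exists m => //; exists (m ** x n).
have small n z : n.+1%:R * rnorm (m (x n z)) ^+ 2 <=
    rnorm z ^+ 2 - rnorm (x n.+1 z) ^+ 2.
  elim: n => [|n IHn].
    by rewrite mul1r; have := sub_adj_contraction z m1; rewrite lerBrDr addrC -lerBrDr.
  have := sub_adj_contraction (x n.+1 z) m1.
  have := @sub_adj_contraction _ _ _ (adj m) (m (x n z)); rewrite rnorm_adj adjK => /(_ m1).
  have -> : m (x n z) - m (adj m (m (x n z))) = m (x n.+1 z).
    by rewrite -[RHS]bop_compE mxS.
  have -> : x n.+1 z - adj m (m (x n.+1 z)) = x n.+2 z by [].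
  have := sqr_ge0 (rnorm (adj m (m (x n z)))).
  have n0 : 0 <= n.+1%:R :> R by [].
  rewrite [n.+2%:R]mulrS mulrDl mul1r.
  move: IHn; move: (rnorm (m (x n z)) ^+ 2) (rnorm (m (x n.+1 z)) ^+ 2).
  move: n0; move: (n.+1%:R) => k k0 a b IHn c0 ab.
  have : k * b <= k * a by rewrite ler_wpM2l//; lra.
  move: IHn; lra.
apply: (closed_subspace_rconv cW Wx) => e e0.
have e2 : 0 < e / 2 by rewrite divr_gt0.
have [N Ne] := natSinv_lt (exprn_gt0 2 e2); exists N => n Nn.
rewrite opprB addrC subrK; apply: (@le_lt_trans _ _ (e / 2)); last first.
  by rewrite ltr_pdivrMr// ltr_pMr ?ltr1n.
apply: rnorm_bop_bound => [|z]; first exact: ltW.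
rewrite -(@ler_pXn2r _ 2)// ?nnegrE ?mulr_ge0 ?rnorm_ge0 ?(ltW e0)//.
have n0 : 0 < n.+1%:R :> R by [].
have n1 : 1 <= n.+1%:R * (e / 2) ^+ 2.
  by rewrite -ler_pdivrMl// mulr1; exact/ltW/Ne.
rewrite exprMn -(ler_pM2l n0) (le_trans (small n z))// mulrA.
apply: le_trans (ler_peMl (sqr_ge0 _) n1).
by rewrite lerBlDr lerDl sqr_ge0.
Qed.

Lemma tro_rmul S c : M S -> closed_span (mul_set (adj_set M) M) c -> M (S ** c).
Proof.
move=> MS; apply: (closed_span_min (closed_subspace_compl S cM)).
rewrite adj_setE => _ [_ [T MT <-] [U MU <-]].
by rewrite /mkset bop_compA; exact: tro_mul.
Qed.

(** [eta] enumerates, rescaled to contractions, left factors from [M] of all e_n together with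
    adjoints of left factors of all f_n. The e_n act as a unit on [M M^*] only, so [M] is reached
    through triples S S^* T: a summand p q^* of e_n turns S S^* T into p (q^* S S^* T), with the
    bracket in [M^* M]. Likewise a summand p^* m of f_n turns c into p^* (m c), with m c in [M]. *)
Lemma tro_generating_sequence :
  has_countable_approximate_identity (closed_span (mul_set M (adj_set M))) ->
  has_countable_approximate_identity (closed_span (mul_set (adj_set M) M)) ->
  exists eta : nat -> bop H K,
    [/\ forall k, M (eta k), forall k, rnorm (eta k) <= 1,
        M `<=` closed_span (mul_set (range eta)
                 (closed_span (mul_set (adj_set M) M))) &
        closed_span (mul_set (adj_set M) M) `<=`
          closed_span (mul_set (range (fun k => adj (eta k))) M)].
Proof.
set A := closed_span (mul_set M _); set C := closed_span (mul_set _ M).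
have cC : closed_subspace C := closed_span_subspace _.
move=> [e [Ae eA]] [f [Cf fC]].
have [F [cF FM Fe]] := countable_left_factors Ae.
have [G [cG GM Gf]] := countable_left_factors Cf.
have [g [gFG FGg]] : exists g : nat -> bop H K,
    (forall n, (F `|` (@adj R K H @` G)) (g n) \/ g n = 0) /\
    F `|` (@adj R K H @` G) `<=` range g.
  apply: countable_enumeration; apply: countableU => //.
  exact: sub_countable (card_image_le _ _) cG.
have Mg k : M (g k).
  case: (gFG k) => [[/FM//|[S GS <-]]|->]; last exact: closed_subspace0.
  by have := GM _ GS; rewrite adj_setE => -[T MT <-]; rewrite adjK.
pose s k : R := 1 + rnorm (g k).
have s0 k : 0 < s k by rewrite ltr_pwDl// rnorm_ge0.
pose eta k := ((s k)^-1)%:C *: g k.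
have gE k : g k = (s k)%:C *: eta k.
  by rewrite scalerA -rmorphM/= divff ?gt_eqF// scale1r.
exists eta; split=> [k|k||].
- exact: closed_subspaceZ.
- by rewrite rnormZr ?invr_ge0 ?(ltW (s0 k))// ler_pdivrMl// mulr1 lerDr.
- set W := closed_span _; have cW : closed_subspace W := closed_span_subspace _.
  apply: subset_trans tro_sub_triple _.
  apply: (closed_span_min cW) => _ [S MS [T MT <-]].
  have /eA[/rnorm_cvgnP eSS _] : A (S ** adj S).
    by apply: sub_closed_span; exists S => //; exists (adj S) => //; exact: adj_setP.
  apply: (closed_subspace_rconv cW _ (rconv_compr T eSS)) => n.
  have Fen := Fe n; rewrite -bop_compA.
  apply: (closed_span_min (closed_subspace_compr _ cW) _ Fen).
  rewrite adj_setE => _ [p Fp [_ [q Mq <-] <-]].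
  have [k _ gk] := FGg p (or_introl Fp).
  rewrite /mkset -gk gE 2!bop_compZl; apply: (closed_subspaceZ _ cW).
  apply: sub_closed_span; exists (eta k); first by exists k.
  exists (adj q ** (S ** adj S ** T)); last by rewrite !bop_compA.
  apply: sub_closed_span; exists (adj q); first exact: adj_setP.
  by exists (S ** adj S ** T) => //; exact: tro_mul.
- set W := closed_span _; have cW : closed_subspace W := closed_span_subspace _.
  move=> c Cc; have [/rnorm_cvgnP fc _] := fC c Cc.
  apply: (closed_subspace_rconv cW _ fc) => n.
  apply: (closed_span_min (closed_subspace_compr _ cW) _ (Gf n)).
  move=> _ [p Gp [m Mm <-]].
  have [k _ gk] := FGg (adj p) (or_intror (ex_intro2 _ _ p Gp erefl)).
  rewrite /mkset -[p]adjK -gk gE adjZ conjC_real 2!bop_compZl.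
  apply: (closed_subspaceZ _ cW); apply: sub_closed_span.
  exists (adj (eta k)); first by exists k.
  by exists (m ** c); [exact: tro_rmul|rewrite bop_compA].
Qed.

End GeneratingSequence.

(** * An operator with dense range in both directions *)

Section Spread.
Variables (R : realType).
Implicit Types H K L : hilbertType R.

(** Decode [k] as a pair with a counter and forget the counter: each pair has infinitely many codes,
    which by the pigeonhole principle exceed every [N]. *)
Lemma recurrent_enumeration : exists idx : nat -> nat * nat,
  forall rs N, exists2 k, (N <= k)%N & idx k = rs.
Proof.
pose idx k : nat * nat := if @unpickle (nat * nat * nat)%type k is Some (rs, _)
  then rs else (0, 0)%N.
exists idx => rs N.
suff [l Nl] : exists l : nat, (N <= pickle (rs, l))%N.
  by exists (pickle (rs, l)); rewrite /idx ?pickleK.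
apply: contrapT => small.
have lt (l : 'I_N.+1) : (pickle (rs, val l) < N)%N.
  by rewrite ltnNge; apply/negP => Nl; apply: small; exists l.
have : injective (fun l => Ordinal (lt l)).
  by move=> l m [] /(pcan_inj pickleK)[] /val_inj.
by move=> /leq_card; rewrite !card_ord ltnn.
Qed.

Variable idx : nat -> nat * nat.
Let r k := (idx k).1.
Let s k := (idx k).2.

(** With two entries per term the factors 2^-(k+2) add up to total norm at most 1. The factor 4^-(r
    k) makes the stray entries of column [i] of order 4^-i, negligible against the weight 2^-(i+2)
    4^-a of its main entry when r i = a is fixed and [i] grows. *)
Definition weight k : R := 2^-1 ^+ k.+2 * 4^-1 ^+ r k.

Definition spread_term H K (eta : nat -> bop H K) k : bop (ell2 H) (ell2 K) :=
  (weight k)%:C *: (place (r k) k (eta (s k)) + place k (r k) (eta (s k))).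

Definition spread H K (eta : nat -> bop H K) n : bop (ell2 H) (ell2 K) :=
  \sum_(k < n) spread_term eta k.

Lemma weight_gt0 k : 0 < weight k.
Proof. by rewrite mulr_gt0 ?exprn_gt0 ?invr_gt0. Qed.

Lemma weight_le k : weight k <= 2^-1 ^+ k.+2.
Proof.
rewrite ler_piMr ?exprn_ge0 ?invr_ge0// exprn_ile1 ?invr_ge0// invf_le1//.
by rewrite ler1n.
Qed.

Lemma spreadS H K (eta : nat -> bop H K) n :
  spread eta n.+1 = spread eta n + spread_term eta n.
Proof. by rewrite /spread big_ord_recr. Qed.

(** This is the purpose of the symmetric placement: T^* is built from the adjoints of [eta] with the
    same indices and weights, so one argument yields both densities. *)
Lemma adj_spread H K (eta : nat -> bop H K) n :
  adj (spread eta n) = spread (fun k => adj (eta k)) n.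
Proof.
rewrite adj_sum; apply: eq_bigr => k _.
by rewrite adjZ conjC_real adjD !adj_place addrC.
Qed.

Section Limit.
Variables (H K : hilbertType R) (eta : nat -> bop H K).
Hypothesis eta1 : forall k, rnorm (eta k) <= 1.

Lemma spread_step k :
  rnorm (spread eta k.+1 - spread eta k) <= - 2^-1 ^+ k.+1 - - 2^-1 ^+ k.
Proof.
rewrite spreadS addrC addrA addNr add0r rnormZr ?(ltW (weight_gt0 _))//.
have pl i j : rnorm (place i j (eta (s k))) <= 1.
  by rewrite (le_trans (rnorm_place _ _ _)).
rewrite (@le_trans _ _ (2^-1 ^+ k.+2 * 2))//.
  rewrite ler_pM ?rnorm_ge0 ?weight_le ?(ltW (weight_gt0 _))//.
  by rewrite (le_trans (rnormD _ _))// lerD.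
rewrite !exprS; move: (2^-1 ^+ k) => w; lra.
Qed.

(** The dominating sequence - 2^-k climbs from -1 and stays below 0, so the total is at most 1,
    which is the contractivity required for the polar decomposition. *)
Lemma spread_cvg : exists2 T, rconv (spread eta) T & rnorm T <= 1.
Proof.
have neg k : - 2^-1 ^+ k <= 0 :> R by rewrite oppr_le0 exprn_ge0 ?invr_ge0.
have [T eT] := bop_complete (rcauchy_telescope spread_step neg).
exists T => //; rewrite -[T]subr0; apply: (rconv_le eT (N := 0%N)) => n _.
rewrite (_ : 0 = spread eta 0); last by rewrite /spread big_ord0.
rewrite (le_trans (telescope_le spread_step (leq0n n)))// expr0 opprK.
by have := neg n; lra.
Qed.

(* Column [i] consists of an entry in row [r i] and of the entries of index [k]
   with [r k = i], whose weights all carry the factor [4 ^- i]. *)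
Lemma spread_place (G : hilbertType R) (c : bop G H) i j n :
  rnorm (spread eta n ** place i j c -
    (if (i < n)%N then weight i else 0)%:C *: place (r i) j (eta (s i) ** c)) <=
  (1 - 2^-1 ^+ n) * (4^-1 ^+ i * rnorm c).
Proof.
elim: n => [|n IHn].
  by rewrite /spread big_ord0 bop_comp0l scale0r subr0 rnorm0 subrr mul0r.
rewrite spreadS bop_compDl.
have -> : (if (i < n.+1)%N then weight i else 0)%:C =
    (if (i < n)%N then weight i else 0)%:C + (if n == i then weight n else 0)%:C :> R[i].
  rewrite -rmorphD/=; congr (_%:C); rewrite ltnS leq_eqVlt eq_sym.
  by have [->|] := eqVneq n i; rewrite ?ltnn ?add0r// addr0.
rewrite scalerDl opprD addrACA (le_trans (rnormD _ _))//.
rewrite exprS [leRHS](_ : _ = (1 - 2^-1 ^+ n) * (4^-1 ^+ i * rnorm c) +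
  2^-1 ^+ n.+1 * (4^-1 ^+ i * rnorm c)); last by rewrite exprS; field.
apply: lerD => //.
(* Of the two entries of the new term, the one in column [n] counts only if n = i, and is then the
   subtracted main entry; the one in column [r n] is the error, present only if r n = i. *)
rewrite bop_compZl bop_compDl !place_comp.
rewrite (_ : _ - _ = (weight n)%:C *:
    (if r n == i then place n j (eta (s n) ** c) else 0)); last first.
  rewrite scalerDr [X in X - _]addrC -addrA; case: (eqVneq n i) => [->|_].
    by rewrite subrr addr0.
  by rewrite scaler0 scale0r subrr addr0.
rewrite rnormZr ?(ltW (weight_gt0 _))//.
have [rni|_] := eqVneq; last by rewrite rnorm0 mulr0 !mulr_ge0 ?exprn_ge0 ?invr_ge0 ?rnorm_ge0.
have half : 2^-1 ^+ n.+2 <= 2^-1 ^+ n.+1 :> R.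
  by rewrite [leLHS]exprS ler_piMl ?exprn_ge0 ?invr_ge0// invf_le1// ler1n.
rewrite /weight rni -mulrA; apply: (ler_pM _ _ half).
- by apply: exprn_ge0; rewrite invr_ge0.
- by rewrite mulr_ge0 ?rnorm_ge0// exprn_ge0 ?invr_ge0.
rewrite ler_wpM2l ?exprn_ge0 ?invr_ge0//.
rewrite (le_trans (rnorm_place _ _ _))// (le_trans (rnorm_comp _ _))//.
by rewrite ler_piMl ?rnorm_ge0.
Qed.

Hypothesis idxP : forall rs N, exists2 k, (N <= k)%N & idx k = rs.

(** Choose a large [i] with idx i = (a, b) and divide by the weight of column [i]. The error becomes
    at most 2^(i+2) 4^a 4^-i |c| = 4 4^a |c| 2^-i; the constant [q] is this coefficient of 2^-i plus
    1, to be positive. *)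
Lemma spread_range_entry T (G : hilbertType R) (c : bop G H) a b j e :
  rconv (spread eta) T -> 0 < e ->
  exists i (t : R), rnorm (place a j (eta b ** c) - T ** place i j (t%:C *: c)) < e.
Proof.
move=> eT e0; pose q := 4 * 4 ^+ a * rnorm c + 1.
have q0 : 0 < q by rewrite ltr_wpDl// !mulr_ge0 ?exprn_ge0 ?rnorm_ge0.
have [N Ne] := natSinv_lt (divr_gt0 e0 q0).
have [i Ni ii] := idxP (a, b) N; exists i, (weight i)^-1.
have wi := weight_gt0 i.
have lim : rnorm (T ** place i j c - (weight i)%:C *: place a j (eta b ** c)) <=
    4^-1 ^+ i * rnorm c.
  apply: (rconv_le (rconv_compr (place i j c) eT) (N := i.+1)) => n ni.
  have := spread_place c i j n; rewrite ni /r /s ii => /le_trans; apply.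
  apply: ler_piMl; first by rewrite mulr_ge0 ?rnorm_ge0// exprn_ge0 ?invr_ge0.
  by rewrite lerBlDr lerDl; apply: exprn_ge0; rewrite invr_ge0.
rewrite placeZ bop_compZr rnormB.
rewrite (_ : _ - _ = ((weight i)^-1)%:C *: (T ** place i j c -
    (weight i)%:C *: place a j (eta b ** c))); last first.
  by rewrite scalerBr scalerA -rmorphM/= mulVf ?gt_eqF// scale1r.
rewrite rnormZr ?invr_ge0 ?(ltW wi)//.
have h : 2^-1 ^+ i * q < e.
  rewrite -ltr_pdivlMr//; apply: le_lt_trans (Ne i Ni).
  rewrite exprVn lef_pV2 ?posrE ?exprn_gt0// -natrX ler_nat.
  exact: ltn_expl.
apply: le_lt_trans h; rewrite (@le_trans _ _ ((weight i)^-1 * (4^-1 ^+ i * rnorm c)))//.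
  by rewrite ler_wpM2l ?invr_ge0// ltW.
have -> : (weight i)^-1 * (4^-1 ^+ i * rnorm c) = 2^-1 ^+ i * (4 * 4 ^+ a * rnorm c).
  rewrite /weight /r ii /= !exprS !exprVn (_ : 4 ^+ i = 2 ^+ i * 2 ^+ i :> R).
    by field; rewrite !expf_neq0.
  by rewrite -exprMn; congr (_ ^+ _); rewrite -natrM.
by rewrite ler_wpM2l ?exprn_ge0 ?invr_ge0// lerDl.
Qed.

Lemma spread_range_dense T (G : hilbertType R) (D : set (bop G H))
    (E : set (bop G K)) :
  rconv (spread eta) T -> closed_subspace D ->
  E `<=` closed_span (mul_set (range eta) D) ->
  Kinfty E `<=` closure [set T ** c | c in Kinfty D].
Proof.
move=> eT cD ED; have cK := Kinfty_subspace cD.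
set W := closure _; have cW : closed_subspace W.
  apply: closure_is_subspace; split.
    by exists 0; rewrite ?bop_comp0r//; exact: (closed_subspace0 cK).
  move=> a _ _ [x Kx <-] [y Ky <-].
  by exists (a *: x + y); [exact: (closed_subspaceZD _ cK)|rewrite bop_compDr bop_compZr].
apply: (Kinfty_min cW) => a j m /ED.
apply: (closed_span_min (closed_subspace_place a j cW)).
move=> _ [_ [b _ <-] [d Dd <-]]; apply/rnorm_closureP => e e0.
have [i [t lt]] := @spread_range_entry T G d a b j e eT e0.
exists (T ** place i j (t%:C *: d)) => //; exists (place i j (t%:C *: d)) => //.
by apply: Kinfty_place => //; exact: closed_subspaceZ.
Qed.

End Limit.

End Spread.

(** * The partial isometry attached to a single TRO *)

Section Stabilisation.
Variables (R : realType) (H K : hilbertType R) (M : set (bop H K)).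

Lemma closed_subspace_adj_set : closed_subspace M -> closed_subspace (adj_set M).
Proof.
move=> /closed_subspace_adj; congr closed_subspace; rewrite adj_setE.
apply/seteqP; split=> [T MT|_ [T MT <-]]; last by rewrite /mkset adjK.
by exists (adj T); rewrite ?adjK.
Qed.

Lemma tro_stabilisation (C := closed_span (mul_set (adj_set M) M)) : TRO M ->
  has_countable_approximate_identity (closed_span (mul_set M (adj_set M))) ->
  has_countable_approximate_identity C ->
  exists U : bop (ell2 H) (ell2 K),
    [/\ rnorm U <= 1,
        forall c, Kinfty C c -> Kinfty M (U ** c) /\ adj U ** U ** c = c &
        forall n, Kinfty M n -> Kinfty C (adj U ** n) /\ U ** adj U ** n = n].
Proof.
move=> troM aA aC; have cM : closed_subspace M := troM.1.
have cC : closed_subspace C := closed_span_subspace _.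
have [eta [Meta eta1 MF CF]] := tro_generating_sequence troM aA aC.
have [idx idxP] := recurrent_enumeration.
have [T eT T1] := spread_cvg idx eta1.
have eta1' k : rnorm (adj (eta k)) <= 1 by rewrite rnorm_adj.
have eT' : rconv (spread idx (fun k => adj (eta k))) (adj T).
  rewrite (_ : spread _ _ = fun n => adj (spread idx eta n)).
    exact: rconv_adj.
  by apply/funext => n; rewrite adj_spread.
have cKM := Kinfty_subspace cM.
have KT : Kinfty M T.
  apply: (closed_subspace_rconv cKM _ eT) => n.
  apply: (closed_subspace_sum _ cKM) => k _; apply: (closed_subspaceZ _ cKM).
  by apply: (closed_subspaceD cKM); exact: Kinfty_place.
have KT' : Kinfty (adj_set M) (adj T).
  by apply: (Kinfty_adj (closed_subspace_adj_set cM) _ KT) => S; exact: adj_setP.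
apply: (polar_equivalence T1) => //.
- exact: Kinfty_subspace.
- by move=> c; apply: (Kinfty_comp cM) KT => S d; exact: tro_rmul.
- move=> n; apply: (Kinfty_comp cC) KT' => S d MS Md; apply: sub_closed_span.
  by exists S => //; exists d.
- exact: (spread_range_dense eta1 idxP eT cC MF).
- exact: (spread_range_dense eta1' idxP eT' cM CF).
Qed.

End Stabilisation.

(** * Stable isomorphism *)

Section MatrixNorm.
Variables (R : realType).
Implicit Types H K : hilbertType R.

Lemma mx_opnorm_has_sup H K n (A : 'M[bop H K]_n) :
  has_sup [set Num.sqrt (\sum_i rnorm (\sum_j A i j (x j)) ^+ 2)
       | x in [set x : 'I_n -> H | \sum_j rnorm (x j) ^+ 2 <= 1]].
Proof.
split.
  exists (Num.sqrt (\sum_i rnorm (\sum_j A i j 0) ^+ 2)), (fun=> 0) => //=.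
  by rewrite big1// => j _; rewrite rnorm0 expr0n.
exists (Num.sqrt (\sum_i (\sum_j rnorm (A i j)) ^+ 2)) => _ [x /= x1 <-].
apply: ler_wsqrtr; apply: ler_sum => i _.
have s0 : 0 <= \sum_j rnorm (A i j) by apply: sumr_ge0 => j _; exact: rnorm_ge0.
rewrite ler_pXn2r ?nnegrE ?rnorm_ge0//.
have xj j : rnorm (x j) <= 1.
  rewrite -(@ler_pXn2r _ 2)// ?nnegrE ?rnorm_ge0// expr1n (le_trans _ x1)//.
  by rewrite (bigD1 j)//= lerDl sumr_ge0// => k _; rewrite sqr_ge0.
elim/big_rec2: _ => [|j y z _ yz]; first by rewrite rnorm0.
rewrite (le_trans (rnormD _ _))// lerD//.
by rewrite (le_trans (rnorm_bop_apply _ _))// ler_piMr ?rnorm_ge0.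
Qed.

Lemma contraction_apply H K (V : bop H K) x : rnorm V <= 1 -> rnorm (V x) <= rnorm x.
Proof.
by move=> V1; rewrite (le_trans (rnorm_bop_apply _ _))// ler_piMl ?rnorm_ge0.
Qed.

(** [V] and [W] act entry by entry, hence as contractions between finite Hilbert sums. Applied to a
    map of this form and to an inverse of the same form, it gives a complete isometry. *)
Lemma mx_opnorm_compress H K H' K' n (A : 'M[bop H K]_n) (B : 'M[bop H' K']_n)
    (V : bop K K') (W : bop H' H) :
  rnorm V <= 1 -> rnorm W <= 1 -> (forall i j, B i j = V ** A i j ** W) ->
  mx_opnorm B <= mx_opnorm A.
Proof.
move=> V1 W1 BE; apply: ge_sup; first by have [] := mx_opnorm_has_sup B.
move=> _ [x /= x1 <-].
apply: (@le_trans _ _ (Num.sqrt (\sum_i rnorm (\sum_j A i j (W (x j))) ^+ 2))).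
  apply: ler_wsqrtr; apply: ler_sum => i _.
  rewrite ler_pXn2r ?nnegrE ?rnorm_ge0//.
  under eq_bigr do rewrite BE !bop_compE.
  by rewrite -linear_sum contraction_apply.
apply: (sup_upper_bound (mx_opnorm_has_sup A)); exists (fun j => W (x j)) => //=.
rewrite (le_trans _ x1)//; apply: ler_sum => j _.
by rewrite ler_pXn2r ?nnegrE ?rnorm_ge0// contraction_apply.
Qed.

End MatrixNorm.

Section Triple.
Variables (R : realType) (H1 H2 K1 K2 : hilbertType R).
Implicit Types (A : set (bop H2 K2)) (B : set (bop H1 H2)) (C : set (bop K1 H1)).

Lemma Kinfty_triple A B C (Z : set (bop K1 K2)) : closed_subspace Z ->
  (forall a b c, A a -> B b -> C c -> Z (a ** b ** c)) ->
  forall S T U, Kinfty A S -> Kinfty B T -> Kinfty C U -> Kinfty Z (S ** T ** U).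
Proof.
move=> cZ ABC S T U KS KT KU.
have cAB : closed_subspace (closed_span (mul_set A B)) := closed_span_subspace _.
apply: (Kinfty_comp cZ _ (Kinfty_comp cAB _ KS KT) KU).
  move=> d c ABd Cc.
  apply: (closed_span_min (closed_subspace_compr c cZ) _ ABd).
  by move=> _ [a Aa [b Bb <-]]; exact: ABC.
by move=> a b Aa Bb; apply: sub_closed_span; exists a => //; exists b.
Qed.

Lemma Kinfty_triple_min A B C (Z : set (bop K1 K2)) W :
  closed_subspace A -> closed_subspace B -> closed_subspace C ->
  closed_subspace W ->
  Z `<=` closed_span (mul_set (mul_set A B) C) ->
  (forall S T U, Kinfty A S -> Kinfty B T -> Kinfty C U -> W (S ** T ** U)) ->
  Kinfty Z `<=` W.
Proof.
move=> cA cB cC cW ZABC KW; apply: (Kinfty_min cW) => i j z /ZABC.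
apply: (closed_span_min (closed_subspace_place i j cW)).
move=> _ [_ [a Aa [b Bb <-]] [c Cc <-]]; rewrite /mkset.
(* A matrix with the single entry a b c factors through the auxiliary index 0. *)
have := KW (place i 0 a) (place 0 0 b) (place 0 j c).
by rewrite !place_comp /=; apply; exact: Kinfty_place.
Qed.

End Triple.

Section SelfAdjoint.
Variables (R : realType) (H K : hilbertType R) (M : set (bop H K)).

Lemma Kinfty_coefficients_adj T :
  Kinfty (closed_span (mul_set (adj_set M) M)) T ->
  Kinfty (closed_span (mul_set (adj_set M) M)) (adj T).
Proof.
set C := closed_span _; have cC : closed_subspace C := closed_span_subspace _.
apply: (Kinfty_adj cC); apply: (closed_span_min (closed_subspace_adj cC)).
rewrite {1}adj_setE => _ [_ [S MS <-] [U MU <-]].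
rewrite /mkset adj_comp adjK; apply: sub_closed_span.
by exists (adj U); [exact: adj_setP|exists S].
Qed.

End SelfAdjoint.

Section TROEquivalence.
Variables (R : realType) (H1 H2 K1 K2 : hilbertType R).
Variables (X : set (bop K1 K2)) (Y : set (bop H1 H2)).
Variables (M1 : set (bop H1 K1)) (M2 : set (bop H2 K2)).
Hypothesis XY : strongly_TRO_equivalent_by X Y M1 M2.

Let tro1 : TRO M1. Proof. by case: XY. Qed.
Let tro2 : TRO M2. Proof. by case: XY. Qed.
Let XE : X = closed_span (mul_set (mul_set M2 Y) (adj_set M1)).
Proof. by case: XY. Qed.
Let YE : Y = closed_span (mul_set (mul_set (adj_set M2) X) M1).
Proof. by case: XY. Qed.

Let C1 := closed_span (mul_set (adj_set M1) M1).
Let C2 := closed_span (mul_set (adj_set M2) M2).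

Let cX : closed_subspace X. Proof. rewrite XE; exact: closed_span_subspace. Qed.
Let cY : closed_subspace Y. Proof. rewrite YE; exact: closed_span_subspace. Qed.

Lemma tro_equivalent_triple m y q : M2 m -> Y y -> adj_set M1 q -> X (m ** y ** q).
Proof.
move=> Mm Yy Mq; rewrite XE; apply: sub_closed_span.
by exists (m ** y); [exists m => //; exists y|exists q].
Qed.

(** Writing y as p x m_1 with p in M_2^* and m_1 in M_1, the factors are absorbed by the TRO's: m_1
    s^* m stays in M_1, and s^* m p stays in M_2^*. *)
Lemma tro_equivalent_module c y d : C2 c -> Y y -> C1 d -> Y (c ** y ** d).
Proof.
move=> Cc Yy Cd; suff Ycy : Y (c ** y).
  apply: (closed_span_min (closed_subspace_compl _ cY) _ Cd).
  move: (c ** y) Ycy => z Yz; rewrite adj_setE => _ [_ [s Ms <-] [m Mm <-]].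
  move: Yz; rewrite {1}YE.
  apply: (closed_span_min (closed_subspace_compr _ cY)).
  move=> _ [_ [p Mp [x Xx <-]] [m1 Mm1 <-]]; rewrite YE; apply: sub_closed_span.
  exists (p ** x); first by exists p => //; exists x.
  by exists (m1 ** adj s ** m); [exact: tro_mul|rewrite !bop_compA].
apply: (closed_span_min (closed_subspace_compr _ cY) _ Cc).
rewrite adj_setE => _ [_ [s Ms <-] [m Mm <-]].
move: Yy; rewrite {1}YE; apply: (closed_span_min (closed_subspace_compl _ cY)).
rewrite {1}adj_setE => _ [_ [_ [t Mt <-] [x Xx <-]] [m1 Mm1 <-]].
rewrite YE; apply: sub_closed_span.
exists (adj s ** m ** adj t ** x); last by exists m1; rewrite ?bop_compA.
exists (adj s ** m ** adj t); last by exists x.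
rewrite adj_setE; exists (t ** adj m ** s); first exact: tro_mul.
by rewrite !adj_comp adjK bop_compA.
Qed.

(** Substitute Y = [M_2^* X M_1] and X = [M_2 Y M_1^*] into each other. Hence operators acting as
    the identity on K(C_1) and K(C_2) do so on K(Y). *)
Lemma tro_equivalent_nondegenerate : Y `<=` closed_span (mul_set (mul_set C2 Y) C1).
Proof.
set W := closed_span _; have cW : closed_subspace W := closed_span_subspace _.
rewrite {1}YE; apply: (closed_span_min cW) => _ [_ [p Mp [x Xx <-]] [m Mm <-]].
move: Xx; rewrite {1}XE; apply: (closed_span_min (closed_subspace_comp p m cW)).
move=> _ [_ [n Mn [y Yy <-]] [q Mq <-]]; apply: sub_closed_span.
exists (p ** n ** y); last first.
  exists (q ** m); last by rewrite !bop_compA.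
  by apply: sub_closed_span; exists q => //; exists m.
exists (p ** n); last by exists y.
by apply: sub_closed_span; exists p => //; exists n.
Qed.

Lemma tro_equivalent_stably_isomorphic :
  has_countable_approximate_identity (closed_span (mul_set M2 (adj_set M2))) ->
  has_countable_approximate_identity (closed_span (mul_set M1 (adj_set M1))) ->
  has_countable_approximate_identity C2 ->
  has_countable_approximate_identity C1 ->
  stably_isomorphic X Y.
Proof.
move=> aA aB aC aD.
have [U1 [U1le U1C U1M]] := tro_stabilisation tro1 aB aD.
have [U2 [U2le U2C U2M]] := tro_stabilisation tro2 aA aC.
have cM1 : closed_subspace M1 := tro1.1.
have cM2 : closed_subspace M2 := tro2.1.
have cM1' := closed_subspace_adj_set cM1.
have cC1 : closed_subspace C1 := closed_span_subspace _.
have cC2 : closed_subspace C2 := closed_span_subspace _.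
have cKX := Kinfty_subspace cX; have cKY := Kinfty_subspace cY.
have KM1 q : Kinfty (adj_set M1) q -> Kinfty M1 (adj q).
  by apply: (Kinfty_adj cM1) => T; rewrite adj_setE => -[S MS <-]; rewrite adjK.
(* On x = m y q the product regroups as (U_2^* m) y (q U_1), where q U_1 is the adjoint of U_1^*
   q^*; the outer factors lie in K(C_2) and K(C_1). *)
have toY x : Kinfty X x -> Kinfty Y (adj U2 ** x ** U1).
  move: x; apply: (Kinfty_triple_min cM2 cY cM1' (closed_subspace_comp _ _ cKY)).
    by rewrite -XE.
  move=> m y q Km Ky Kq; rewrite /mkset.
  have [Kc _] := U2M _ Km; have [Kd _] := U1M _ (KM1 _ Kq).
  rewrite !bop_compA -(bop_compA _ q U1).
  apply: (Kinfty_triple cY tro_equivalent_module) => //.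
  by rewrite -[q ** U1]adjK adj_comp; exact: Kinfty_coefficients_adj.
have toX y : Kinfty Y y -> Kinfty X (U2 ** y ** adj U1).
  move: y; apply: (Kinfty_triple_min cC2 cY cC1 (closed_subspace_comp _ _ cKX)).
    exact: tro_equivalent_nondegenerate.
  move=> c y d Kc Ky Kd; rewrite /mkset.
  have [Km _] := U2C _ Kc; have [Kn _] := U1C _ (Kinfty_coefficients_adj Kd).
  rewrite !bop_compA -(bop_compA _ d).
  apply: (Kinfty_triple cX tro_equivalent_triple) => //.
  rewrite -[d]adjK -adj_comp.
  by apply: (Kinfty_adj cM1' _ Kn) => T; exact: adj_setP.
have fixX x : Kinfty X x -> U2 ** adj U2 ** x = x /\ x ** (U1 ** adj U1) = x.
  move=> Kx; split; move: x Kx.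
    apply: (Kinfty_triple_min cM2 cY cM1' (closed_subspace_fix _ _)).
      by rewrite -XE.
    move=> m y q Km _ _; have [_ fm] := U2M _ Km.
    by rewrite /mkset !bop_compA fm.
  apply: (Kinfty_triple_min cM2 cY cM1' (closed_subspace_fixr _ _)).
    by rewrite -XE.
  (* The identity on the right is the adjoint of U_1 U_1^* q^* = q^*. *)
  move=> m y q _ _ Kq; have [_ fq] := U1M _ (KM1 _ Kq).
  rewrite /mkset -!bop_compA; congr (_ ** (_ ** _)).
  by rewrite -[RHS]adjK -fq !adj_comp !adjK.
have fixY y : Kinfty Y y -> adj U2 ** U2 ** y = y /\ y ** (adj U1 ** U1) = y.
  move=> Ky; split; move: y Ky.
    apply: (Kinfty_triple_min cC2 cY cC1 (closed_subspace_fix _ _)).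
      exact: tro_equivalent_nondegenerate.
    move=> c y d Kc _ _; have [_ fc] := U2C _ Kc.
    by rewrite /mkset !bop_compA fc.
  apply: (Kinfty_triple_min cC2 cY cC1 (closed_subspace_fixr _ _)).
    exact: tro_equivalent_nondegenerate.
  move=> c y d _ _ Kd; have [_ fd] := U1C _ (Kinfty_coefficients_adj Kd).
  rewrite /mkset -!bop_compA; congr (_ ** (_ ** _)).
  by rewrite -[RHS]adjK -fd !adj_comp !adjK.
pose phi x := adj U2 ** x ** U1.
have phiK x : Kinfty X x -> U2 ** phi x ** adj U1 = x.
  move=> /fixX[l r]; rewrite /phi !bop_compA -bop_compA l; exact: r.
exists phi; split=> [a S T _ _||n A XA].
- by rewrite /phi bop_compDr bop_compZr bop_compDl bop_compZl.
- apply/seteqP; split=> [_ [x Kx <-]|y Ky]; first exact: toY.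
  exists (U2 ** y ** adj U1); first exact: toX.
  have [l r] := fixY y Ky.
  by rewrite /phi !bop_compA -(bop_compA _ (adj U1)) l.
- apply/eqP; rewrite eq_le; apply/andP; split.
    apply: (@mx_opnorm_compress _ _ _ _ _ _ _ _ (adj U2) U1) => //.
      by rewrite rnorm_adj.
    by move=> i j; rewrite mxE.
  apply: (@mx_opnorm_compress _ _ _ _ _ _ _ _ U2 (adj U1)) => //.
    by rewrite rnorm_adj.
  by move=> i j; rewrite mxE phiK.
Qed.

End TROEquivalence.

Theorem corollary4p7 (R : realType) (H1 H2 K1 K2 : hilbertType R)
    (X : set (bop K1 K2)) (Y : set (bop H1 H2))
    (M1 : set (bop H1 K1)) (M2 : set (bop H2 K2)) :
  operator_space X -> operator_space Y ->
  strongly_TRO_equivalent_by X Y M1 M2 ->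
  has_countable_approximate_identity (closed_span (mul_set M2 (adj_set M2))) ->
  has_countable_approximate_identity (closed_span (mul_set M1 (adj_set M1))) ->
  has_countable_approximate_identity (closed_span (mul_set (adj_set M2) M2)) ->
  has_countable_approximate_identity (closed_span (mul_set (adj_set M1) M1)) ->
  stably_isomorphic X Y.
Proof.
move=> _ _ XY; exact: tro_equivalent_stably_isomorphic XY.
Qed.
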